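(* Let $k\geq 1$. For any self-conjugate Young diagram $\lambda$, we have $$\sum_{T \in \mathcal{ST}_{\lambda}(I_k)}t^{\mathrm{Peak}(T)} = \sum_{T \in \mathcal{ST}_{\lambda}(I_k)}t^{\mathrm{Val}(T)} = \sum_{T \in \mathcal{ST}_{\lambda}(J_k)}t^{\mathrm{Val}(T)} = \sum_{T \in \mathcal{ST}_{\lambda}(J_k)}t^{\mathrm{Peak}(T)}.$$
   Context: Young diagrams are identified with integer partitions and drawn left-justified; the square $(i,j)$ is the square in the $i$-th column (columns numbered left to right) and $j$-th row (rows numbered top to bottom). $c_j(\lambda)$ denotes the length of the $j$-th column of $\lambda$. $\lambda$ is self-conjugate if it equals its reflection $\lambda^T$ along the main diagonal. A transversal $T$ of shape $\lambda$ is a $01$-filling of the squares of $\lambda$ such that each row and each column contains exactly one $1$. If $\lambda$ has $n$ columns, write $T=t_1t_2\cdots t_n$, where the $1$ in column $i$ is in the square $(i,t_i)$. A transversal of a self-conjugate Young diagram $\lambda$ is symmetric if the square $(i,j)$ contains a $1$ if and only if the square $(j,i)$ contains a $1$. $\mathcal{ST}_\lambda$ is the set of symmetric transversals of the self-conjugate diagram $\lambda$. An index $i$ with $2\le i\le n-1$ and $c_{i-1}(\lambda)=c_i(\lambda)=c_{i+1}(\lambda)$ is a peak of $T$ if $t_{i-1}<t_i>t_{i+1}$ and a valley of $T$ if $t_{i-1}>t_i<t_{i+1}$. $\mathrm{Peak}(T)$ and $\mathrm{Val}(T)$ are the sets of peaks and of valleys of $T$. $T$ contains a pattern $\sigma\in\mathcal{S}_m$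 (a permutation of $\{1,\dots,m\}$) if there are rows $r_1<\cdots<r_m$ and columns $c_1<\cdots<c_m$ such that every square $(c_i,r_j)$ lies in $\lambda$ and the restriction of $T$ to these rows and columns is the permutation matrix of $\sigma$ (i.e. the $1$'s are exactly in squares $(c_i,r_{\sigma_i})$). Otherwise $T$ avoids $\sigma$. $\mathcal{ST}_\lambda(\sigma)$ is the set of $\sigma$-avoiding transversals in $\mathcal{ST}_\lambda$. $I_k=12\cdots k$ and $J_k=k\cdots 21$. For a finite set $A$ of positive integers, $t^A=\prod_{i\in A}t_i$ with $t_1,t_2,\ldots$ commuting indeterminates, and $t^{\emptyset}=1$. *)

(* Defs.v *)
From mathcomp Require Import all_boot all_order all_fingroup all_algebra.
From mathcomp.multinomials Require Import mpoly.

Set Implicit Arguments.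
Unset Strict Implicit.
Unset Printing Implicit Defensive.

(* A Young diagram is the sequence of its (positive, weakly decreasing) row
   lengths.  All row and column numbers below are natural numbers starting
   at 1, and the square (i, j) lies in column i and row j. *)
Definition is_partition (la : seq nat) : bool := sorted geq la && (0 \notin la).

Definition nrows (la : seq nat) : nat := size la.
Definition ncols (la : seq nat) : nat := head 0 la.

Definition row_len (la : seq nat) (j : nat) : nat := nth 0 la j.-1.
Definition col_len (la : seq nat) (i : nat) : nat := count (fun r => i <= r) la.

Definition conj_part (la : seq nat) : seq nat :=
  [seq col_len la i | i <- iota 1 (ncols la)].

Definition self_conjugate (la : seq nat) : bool := conj_part la == la.

Definition squares (la : seq nat) : seq (nat * nat) :=
  [seq (i, j) | j <- iota 1 (nrows la), i <- iota 1 (row_len la j)].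

Notation filling la := {ffun seq_sub (squares la) -> bool}.

(* [has_one T i j]: (i, j) is a square of the diagram and it contains a 1. *)
Definition has_one (la : seq nat) (T : filling la) (i j : nat) : bool :=
  if insub (i, j) is Some s then T s else false.

Definition transversal (la : seq nat) (T : filling la) : bool :=
  all (fun i => count (fun j => has_one T i j) (iota 1 (nrows la)) == 1)
      (iota 1 (ncols la)) &&
  all (fun j => count (fun i => has_one T i j) (iota 1 (ncols la)) == 1)
      (iota 1 (nrows la)).

Definition symmetric_filling (la : seq nat) (T : filling la) : bool :=
  all (fun s => has_one T s.1 s.2 == has_one T s.2 s.1) (squares la).

Definition ST (la : seq nat) : {set filling la} :=
  [set T : filling la | transversal T & symmetric_filling T].

(* The row t_i of the 1 in column i (meaningful for a transversal T). *)
Definition one_row (la : seq nat) (T : filling la) (i : nat) : nat :=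
  head 0 [seq j <- iota 1 (nrows la) | has_one T i j].

Definition flat_at (la : seq nat) (i : nat) : bool :=
  [&& 2 <= i, i <= (ncols la).-1,
      col_len la i.-1 == col_len la i & col_len la i == col_len la i.+1].

(* Index sets are subsets of {0, ..., n}, n the number of columns, so that an
   ordinal is literally the 1-based column number; 0 never occurs. *)
Definition Peak (la : seq nat) (T : filling la) : {set 'I_(ncols la).+1} :=
  [set i : 'I_(ncols la).+1 |
    [&& flat_at la i, one_row T i.-1 < one_row T i
                    & one_row T i.+1 < one_row T i]].

Definition Val (la : seq nat) (T : filling la) : {set 'I_(ncols la).+1} :=
  [set i : 'I_(ncols la).+1 |
    [&& flat_at la i, one_row T i < one_row T i.-1
                    & one_row T i < one_row T i.+1]].

(* Permutations of {1, ..., m} are represented by 'S_m, i.e. shifted to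
   {0, ..., m - 1}.  The third conjunct excludes row and column number 0. *)
Definition contains_pattern (la : seq nat) (T : filling la)
    (m : nat) (s : 'S_m) : bool :=
  [exists r : {ffun 'I_m -> 'I_(nrows la).+1},
   exists c : {ffun 'I_m -> 'I_(ncols la).+1},
    [&& [forall a : 'I_m, forall b : 'I_m, (a < b) ==> (r a < r b)],
        [forall a : 'I_m, forall b : 'I_m, (a < b) ==> (c a < c b)],
        [forall a : 'I_m, forall b : 'I_m,
          (nat_of_ord (c a), nat_of_ord (r b)) \in squares la]
      & [forall a : 'I_m, forall b : 'I_m, has_one T (c a) (r b) == (b == s a)]]].

Definition ST_avoiding (la : seq nat) (m : nat) (s : 'S_m) : {set filling la} :=
  [set T in ST la | ~~ contains_pattern T s].

Definition Ipat (k : nat) : 'S_k := perm_one 'I_k.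
Definition Jpat (k : nat) : 'S_k := perm (@rev_ord_inj k).

(* t^A, in the polynomial ring Z[t_0, ..., t_n] (t_0 is never used). *)
Definition tmon (n : nat) (A : {set 'I_n.+1}) : {mpoly int[n.+1]} :=
  (\prod_(i in A) 'X_i)%R.

(* Main.v *)
Require Import Defs.
From mathcomp Require Import all_boot all_order all_fingroup all_algebra.
From mathcomp.multinomials Require Import mpoly.
From mathcomp Require Import zify.

(** Fomin's local rules attach a partition to every lattice point of the
    diagram.  Along the boundary, from its bottom left to its top right end,
    every column adds a box to the current shape and every row removes one.
    Write [b] for the word whose [i]-th letter is the row of the box added by
    column [i].  For a symmetric transversal [T] the rows remove boxes from
    the rows prescribed by the same word, so [b] determines all boundary
    shapes, and:
    - the local rules are reversible, hence [T] is determined by [b], and a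
      word arises in this way if and only if all its boundary shapes are
      partitions ([word_valid], [valid_realized], [word_inj]);
    - the first part of a shape is the length of the longest increasing chain
      of the rectangle it stands for, and its number of parts is that of the
      longest decreasing chain ([inc_chain_gshape], [gshape_inc_chain],
      [dec_chain_gshape], [gshape_dec_chain]).  So avoiding [I_k], or [J_k],
      means that the boundary shapes have first part less than [k], or fewer
      than [k] parts;
    - if columns [i] and [i + 1] have the same length, then [t_i < t_(i+1)] if
      and only if [b_(i+1) <= b_i] ([word_ascent]).

    Conjugating all boundary shapes is an involution on words.  It exchanges
    the two avoidance conditions, and by the last fact it turns ascents into
    descents; so it matches peaks over [I_k] with valleys over [J_k] and
    valleys over [I_k] with peaks over [J_k] ([sum_conj]).

    It remains to compare peaks and valleys over [I_k] ([peak_val]).  By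
    inclusion-exclusion it is enough that, for every set [Q] of columns, as
    many [T] have a peak at each element of [Q] as have a valley there.  The
    elements of [Q] at distance two form runs, and a run prescribes on an odd
    number of equal columns the ascent pattern up, down, ..., up, down for
    peaks, and the reverse of that pattern for valleys.  Now reversing the
    ascent pattern of a block of equal columns does not change the number of
    words ([num_rev]): the patterns without descents correspond to horizontal
    strips, whose lengths can be permuted by the Bender-Knuth involution
    ([bkswapP]), and the other patterns reduce to those because the words
    with a descent at some place are the words without condition there minus
    the words with an ascent.  In terms of symmetric functions, a ribbon Schur
    function is a signed sum of products of complete homogeneous functions,
    and these commute. *)

Set Implicit Arguments.
Unset Strict Implicit.
Unset Printing Implicit Defensive.

(** * Growth diagrams by edge labels *)

(** Columns and rows are numbered from 0, and [cell D i j] concerns column [i]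
    and row [j].  A predicate on squares, rather than a sequence of row lengths,
    makes the reflection a mere exchange of arguments. *)
Record sym_diagram (n : nat) := SymDiagram {
  cell :> nat -> nat -> bool;
  cellC : forall i j, cell i j = cell j i;
  cell_down : forall i j i' j', i' <= i -> j' <= j -> cell i j -> cell i' j';
  cell_lt : forall i j, cell i j -> i < n;
  cell_col : forall i, i < n -> cell i 0 }.

(** The last two fields speak of columns; symmetry carries them to rows. *)
Record sym_transversal n (D : sym_diagram n) (x : nat -> nat -> bool) : Prop := SymTransversal {
  transvC : forall i j, x i j = x j i;
  transv_cell : forall i j, x i j -> D i j;
  transv_inj : forall i j j', x i j -> x i j' -> j = j';
  transv_ex : forall i, i < n -> exists j, x i j }.

(** Fomin's local rule, read on edges.  A label 0 means that the shape does not
    change along the edge, a label [r > 0] that its [r]-th part grows by one.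
    Different labels cross unchanged, two equal labels [r > 0] push each other
    to [r + 1], and a 1 in the square creates the label 1 on both outgoing
    edges.  Squares outside the diagram let all labels through, so that the
    labels on the boundary of the diagram can be read on the far sides of the
    [n] by [n] square. *)
Definition cross (d x : bool) (a b : nat) : nat :=
  if d && (a == b) then a + (x || (0 < a)) else a.

(** One function serves both kinds of edges: [label D x i j] belongs to the
    horizontal edge of column [i] at height [j] and, because the bits are
    symmetric, also to the vertical edge of row [i] at abscissa [j].  The
    recursion runs on the sum of the two coordinates. *)
Fixpoint label_rec (D x : nat -> nat -> bool) (s i j : nat) : nat :=
  match s, j with
  | s'.+1, j'.+1 =>
      cross (D i j') (x i j') (label_rec D x s' i j') (label_rec D x s' j' i)
  | _, _ => 0
  end.

Definition label (D x : nat -> nat -> bool) (i j : nat) : nat := label_rec D x (i + j) i j.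

Lemma label0 D x i : label D x i 0 = 0.
Proof. by rewrite /label; case: (i + 0). Qed.

Lemma labelS D x i j :
  label D x i j.+1 = cross (D i j) (x i j) (label D x i j) (label D x j i).
Proof. by rewrite /label addnS /= [j + i]addnC. Qed.

Lemma label_unique D x g :
  (forall i, g i 0 = 0) ->
  (forall i j, g i j.+1 = cross (D i j) (x i j) (g i j) (g j i)) ->
  forall i j, g i j = label D x i j.
Proof.
move=> g0 gS i j; move: {2}(i + j) (leqnn (i + j)) => s.
elim: s i j => [|s IH] i [|j] le_s; rewrite ?g0 ?label0 //; first by lia.
by rewrite gS labelS !IH //; lia.
Qed.

(** The [r]-th part of the shape at the lattice point [(i, j)]: the horizontal
    edges at height [j] lead to it from the vertical axis, where the shape is
    empty. *)
Definition gshape (g : nat -> nat -> nat) i j r := \sum_(k < i) (g k j == r).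

Lemma gshape0l g j r : gshape g 0 j r = 0. Proof. by rewrite /gshape big_ord0. Qed.

Lemma gshapeSl g i j r : gshape g i.+1 j r = gshape g i j r + (g i j == r).
Proof. by rewrite /gshape big_ord_recr. Qed.

(** The local rule without the initial condition [g i 0 = 0], so that it also
    covers labels computed backwards from the boundary. *)
Definition flow (D x : nat -> nat -> bool) (g : nat -> nat -> nat) :=
  (forall i j, x i j = x j i) /\
  (forall i j, g i j.+1 = cross (D i j) (x i j) (g i j) (g j i)).

Section Flow.
Variables (n : nat) (D : sym_diagram n) (x : nat -> nat -> bool) (g : nat -> nat -> nat).
Hypothesis gP : flow D x g.

(** Both ways around a square add the same boxes, so the shapes do not depend
    on the path that leads to a lattice point. *)
Lemma flow_balance i j r :
  (g j i == r) + (g i j.+1 == r) = (g i j == r) + (g j i.+1 == r) :> nat.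
Proof.
case: gP => xC gS; rewrite !gS /cross (cellC D j i) (xC j i) (eq_sym (g j i) (g i j)).
by case: ifP => [/andP[_ /eqP <-] //|_]; rewrite addnC.
Qed.

Lemma flow_gshapeSr i j r :
  gshape g i j.+1 r + (g j 0 == r) = gshape g i j r + (g j i == r).
Proof.
elim: i => [|i IH]; first by rewrite !gshape0l.
by rewrite !gshapeSl; have := flow_balance i j r; lia.
Qed.

Lemma flow_frozen i j k : ~~ D i j -> j <= k -> g i k = g i j.
Proof.
move=> nD /subnK <-; elim: (k - j) => [|m IH] //; rewrite addSn gP.2 /cross IH.
case: ifP => // /andP[Dm _]; case/negP: nD; apply: (cell_down (leqnn i) _ Dm).
exact: leq_addl.
Qed.

(** Telescoping from height [j] down to height [n]: the vertical edges met on
    the way lie outside the diagram and carry their final labels.  So, if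
    no label enters along the axis, the shape at a boundary point is the content
    of the columns on its left minus that of the rows below it. *)
Lemma flow_boundary i j r : j <= n -> ~~ D i j ->
  gshape g i n r + \sum_(j <= k < n) (g k 0 == r)
    = gshape g i j r + \sum_(j <= k < n) (g k n == r).
Proof.
move=> le_jn nD.
have -> : \sum_(j <= k < n) (g k n == r) = \sum_(j <= k < n) (g k i == r).
  apply: eq_big_nat => k /andP[le_jk lt_kn].
  have nDk : ~~ D k i.
    by apply: contra nD; rewrite cellC; apply: cell_down.
  case: (leqP i n) => [/(flow_frozen nDk) -> //|lt_ni].
  rewrite (@flow_frozen k n i) //; last exact: ltnW.
  by apply/negP; rewrite cellC => /cell_lt; rewrite ltnn.
suff telescope m : j <= m ->
    gshape g i m r + \sum_(j <= k < m) (g k 0 == r)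
      = gshape g i j r + \sum_(j <= k < m) (g k i == r) by exact: telescope.
elim: m => [|m IH].
  by rewrite leqn0 => /eqP ->; rewrite !big_geq.
rewrite leq_eqVlt => /orP[/eqP -> |lt_jm]; first by rewrite !big_geq.
rewrite !big_nat_recr //=; have := IH lt_jm; have := flow_gshapeSr i m r; lia.
Qed.

End Flow.

Definition grid_point (D : nat -> nat -> bool) i j := [|| i == 0, j == 0 | D i.-1 j.-1].

Section Labels.
Variables (n : nat) (D : sym_diagram n) (x : nat -> nat -> bool).
Hypothesis xP : sym_transversal D x.
Local Notation h := (label D x).

Lemma label_gt0_ex i j : 0 < h i j -> exists2 k, k < j & x i k.
Proof.
elim: j => [|j IH]; first by rewrite label0.
rewrite labelS /cross; case: ifP => [/andP[_ /eqP E]|_].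
  case xij: (x i j); first by exists j.
  case: (posnP (h i j)) => [->|/IH [k lk xk] _] //; by exists k => //; lia.
by move=> /IH [k lk xk]; exists k => //; lia.
Qed.

Lemma label_before i j : x i j -> h i j = 0.
Proof.
move=> xij; apply/eqP; rewrite -leqn0 leqNgt; apply/negP => /label_gt0_ex [k lk xik].
by rewrite (transv_inj xP xij xik) ltnn in lk.
Qed.

Lemma label_at i j : x i j -> h i j.+1 = 1.
Proof.
move=> xij; rewrite labelS /cross (transv_cell xP xij) !label_before ?xij //.
by rewrite (transvC xP).
Qed.

Lemma label_leS i j : h i j <= h i j.+1.
Proof. by rewrite labelS /cross; case: ifP => // _; lia. Qed.

Lemma label_mono i j k : j <= k -> h i j <= h i k.
Proof.
by move/subnK <-; elim: (k - j) => [|m IH] //; rewrite addSn (leq_trans IH) ?label_leS.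
Qed.

Lemma label_after i j k : x i j -> j < k -> 0 < h i k.
Proof. by move=> /label_at E /(label_mono i); rewrite E. Qed.

Lemma label_le_add i j : h i j <= i + j.
Proof.
elim: j => [|j IH]; first by rewrite label0.
by rewrite labelS /cross; case: ifP => _; lia.
Qed.

Lemma label_flow : flow D x h.
Proof. by split; [apply: transvC xP | move=> i j; rewrite labelS]. Qed.

Local Notation gshape := (gshape h).

Lemma gshapeSr i j r : 0 < r -> gshape i j.+1 r = gshape i j r + (h j i == r).
Proof.
by move=> r0; have := flow_gshapeSr label_flow i j r; rewrite label0; lia.
Qed.

Lemma gshapeC i j r : 0 < r -> gshape i j r = gshape j i r.
Proof.
move=> r0; elim: j => [|j IH]; last by rewrite gshapeSr // gshapeSl IH.
by rewrite gshape0l /gshape big1 // => k _; rewrite label0; lia.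
Qed.

Lemma gshape0r i r : 0 < r -> gshape i 0 r = 0.
Proof. by move=> r0; rewrite gshapeC // gshape0l. Qed.

(** Induction on squares.  If the two labels entering a square differ, the new
    shape is the union of two partitions; if both equal [r > 0], the box added
    to part [r] makes room for the one added to part [r + 1]. *)
Lemma gshape_partition i j r : grid_point D i j -> 0 < r -> gshape i j r.+1 <= gshape i j r.
Proof.
move: {2}(i + j) (leqnn (i + j)) => s.
elim: s i j r => [|s IH] [|i] [|j] r les ip r0.
all: try by rewrite ?gshape0l ?(gshape0r _ r0) ?(gshape0r _ (ltn0Sn r)).
have Dij : D i j by [].
have ip1 : grid_point D i j.+1.
  by rewrite /grid_point /=; case: i Dij {IH les ip} => //= i; apply: cell_down.
have ip2 : grid_point D i.+1 j.
  by rewrite /grid_point /=; case: j Dij {IH les ip ip1} => //= j; apply: cell_down.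
have ip3 : grid_point D i j.
  by rewrite /grid_point /=; case: i j Dij {IH les ip ip1 ip2} => [|i] [|j] //=; apply: cell_down.
have B1 : gshape i j.+1 r.+1 <= gshape i j.+1 r by apply: IH => //; lia.
have B2 : gshape i.+1 j r.+1 <= gshape i.+1 j r by apply: IH => //; lia.
have B3 : gshape i j r.+1 <= gshape i j r by apply: IH => //; lia.
move: B1 B2 B3; rewrite !gshapeSl !(gshapeSr i j) //.
rewrite !labelS /cross Dij /=.
case E: (h i j == h j i); [move/eqP: E => <-| move: E => /eqP E]; lia.
Qed.

End Labels.

(** * The boundary word and its inverse *)

Definition boundary n (D : nat -> nat -> bool) i j :=
  [&& i <= n, j <= n, grid_point D i j & ~~ D i j].

(** By [flow_boundary] this is the shape at the boundary point [(i, j)] when [b]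
    lists the final labels; on valid words the subtraction is exact. *)
Definition bshape (b : seq nat) i j r :=
  count_mem r (take i b) - count_mem r (drop j b).

Record valid n (D : sym_diagram n) (b : seq nat) : Prop := Valid {
  valid_size : size b = n;
  valid_pos : 0 \notin b;
  valid_nneg : forall i j r, boundary n D i j -> 0 < r ->
    count_mem r (drop j b) <= count_mem r (take i b);
  valid_dec : forall i j r, boundary n D i j -> 0 < r ->
    bshape b i j r.+1 <= bshape b i j r }.

(** By symmetry the final labels of the rows form the same word. *)
Definition word n (D x : nat -> nat -> bool) := mkseq (fun i => label D x i n) n.

Lemma count_map_iota (f : nat -> nat) (m k r : nat) :
  count_mem r (map f (iota m k)) = \sum_(m <= i < m + k) (f i == r).
Proof.
rewrite /index_iota addKn -sum1_count big_map big_mkcond.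
by apply: eq_bigr => i _ /=; case: (f i == r).
Qed.

Lemma count_take_mkseq (f : nat -> nat) (n i r : nat) : i <= n ->
  count_mem r (take i (mkseq f n)) = \sum_(k < i) (f k == r).
Proof.
move=> le_in; rewrite /mkseq -map_take take_iota count_map_iota add0n.
by rewrite (minn_idPl le_in) big_mkord.
Qed.

Lemma count_drop_mkseq (f : nat -> nat) (n j r : nat) : j <= n ->
  count_mem r (drop j (mkseq f n)) = \sum_(j <= k < n) (f k == r).
Proof.
by move=> le_jn; rewrite /mkseq -map_drop drop_iota count_map_iota subnKC.
Qed.

Lemma cell_grid_points n (D : sym_diagram n) i j : D i j ->
  [/\ grid_point D i.+1 j.+1, grid_point D i.+1 j, grid_point D i j.+1,
      grid_point D i j & i < n /\ j < n].
Proof.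
move=> Dij; have Dji : D j i by rewrite cellC.
rewrite /grid_point /=; split=> //; last by split; [apply: cell_lt Dij | apply: cell_lt Dji].
- by case: j Dij {Dji} => //= j; apply: cell_down.
- by case: i Dij {Dji} => //= i; apply: cell_down.
- by case: i j Dij {Dji} => [|i] [|j] //=; apply: cell_down.
Qed.

Section Forward.
Variables (n : nat) (D : sym_diagram n) (x : nat -> nat -> bool).
Hypothesis xP : sym_transversal D x.
Local Notation h := (label D x).

Lemma word_count i j r : boundary n D i j -> 0 < r ->
  count_mem r (take i (word n D x))
    = gshape h i j r + count_mem r (drop j (word n D x)).
Proof.
case/and4P=> le_in le_jn _ nD r0.
rewrite count_take_mkseq // count_drop_mkseq //.
have := flow_boundary (label_flow xP) r le_jn nD.
by rewrite big1 ?addn0 // => k _; rewrite label0; lia.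
Qed.

Lemma word_bshape i j r : boundary n D i j -> 0 < r -> bshape (word n D x) i j r = gshape h i j r.
Proof. by move=> bij r0; rewrite /bshape (word_count bij r0) addnK. Qed.

Lemma word_valid : valid D (word n D x).
Proof.
split.
- by rewrite size_mkseq.
- apply/negP => /mapP[i]; rewrite mem_iota => /andP[_ lt_in] E.
  have [j xij] := transv_ex xP lt_in.
  have lt_jn : j < n by have := transv_cell xP xij; rewrite cellC; apply: cell_lt.
  by have := label_after xP xij lt_jn; rewrite -E.
- by move=> i j r bij r0; rewrite (word_count bij r0) leq_addl.
- move=> i j r bij r0; rewrite !word_bshape //; apply: gshape_partition => //.
  by case/and4P: bij.
Qed.

End Forward.

(** The local rule backwards: equal outgoing labels come from equal incoming
    ones, and a pair of labels 1 comes from a 1 of the transversal. *)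
Definition uncross (d : bool) (a b : nat) := if d && (a == b) then a.-1 else a.

Lemma uncrossK d a b :
  cross d [&& d, a == 1 & b == 1] (uncross d a b) (uncross d b a) = a.
Proof.
rewrite /cross /uncross; case: d => //=.
case: (eqVneq a b) => [->|ne] /=; last by rewrite (negPf ne).
by rewrite !eqxx andbb; case: b => [|[|b]] //=; lia.
Qed.

(** [s] counts down to the corner [(n, n)] of the square; beyond its far sides
    the labels are the letters of [b]. *)
Fixpoint back_rec (D : nat -> nat -> bool) (b : seq nat) s i j :=
  if s is s'.+1 then uncross (D i j) (back_rec D b s' i j.+1) (back_rec D b s' j i.+1)
  else nth 0 b i.

Section Backward.
Variables (n : nat) (D : sym_diagram n) (b : seq nat).
Hypothesis bP : valid D b.

Definition back i j := back_rec D b (n + n - (i + j)) i j.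
Definition back_bits i j := [&& D i j, back i j.+1 == 1 & back j i.+1 == 1].

Lemma back_far i j : n <= j -> back i j = nth 0 b i.
Proof.
rewrite /back; move: (_ - _) => s le_nj; elim: s i j le_nj => //= s IH i j le_nj.
rewrite /uncross; case: ifP => [/andP[]|_]; last by rewrite IH // ltnW.
by rewrite cellC => /cell_lt; rewrite ltnNge le_nj.
Qed.

Lemma backE i j : back i j = uncross (D i j) (back i j.+1) (back j i.+1).
Proof.
case: (leqP n j) => [le_nj|lt_jn].
  rewrite /uncross cellC; case: ifP => [/andP[/cell_lt]|_].
    by rewrite ltnNge le_nj.
  by rewrite !back_far // ltnW.
rewrite {1}/back; case: (leqP n i) => [le_ni|lt_in].
  rewrite /uncross; case: ifP => [/andP[/cell_lt]|_].
    by rewrite ltnNge le_ni.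
  rewrite /back; have E : n + n - (i + j) = (n + n - (i + j)).-1.+1 \/ n + n - (i + j) = 0 by lia.
  case: E => E; last by rewrite E (_ : _ - _ = 0) //; lia.
  rewrite E /= /uncross; case: ifP => [/andP[/cell_lt]|_].
    by rewrite ltnNge le_ni.
  by congr back_rec; lia.
have -> : n + n - (i + j) = (n + n - (i + j.+1)).+1 by lia.
by rewrite /= /back; congr uncross; congr back_rec; lia.
Qed.

Lemma back_bitsC i j : back_bits i j = back_bits j i.
Proof. by rewrite /back_bits cellC; case: (D j i) => //=; rewrite andbC. Qed.

Lemma back_flow : flow D back_bits back.
Proof.
split; first exact: back_bitsC.
by move=> i j; rewrite (backE i j) (backE j i) (cellC D j i) uncrossK.
Qed.

(** The labels on the vertical axis are not yet known to vanish; [Z] corrects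
    the shapes for them. *)
Let Z j r := \sum_(j <= k < n) (back k 0 == r).

Lemma back_count i j r : boundary n D i j ->
  count_mem r (take i b) + Z j r = gshape back i j r + count_mem r (drop j b).
Proof.
case/and4P=> le_in le_jn _ nD.
have Eb : b = mkseq (fun k => back k n) n.
  rewrite -{1}(mkseq_nth 0 b) (valid_size bP).
  by apply/eq_mkseq => k; rewrite back_far.
rewrite [X in count_mem r (take i X)]Eb [X in count_mem r (drop j X)]Eb.
rewrite count_take_mkseq // count_drop_mkseq //.
have E := flow_boundary back_flow r le_jn nD; exact E.
Qed.

Lemma back_partition_boundary i j r : grid_point D i j -> i <= n -> j <= n -> 0 < r ->
  D i j = false ->
  Z j r <= gshape back i j r /\
  gshape back i j r.+1 + Z j r <= gshape back i j r + Z j r.+1.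
Proof.
move=> ip le_in le_jn r0 Dij.
have bij : boundary n D i j by rewrite /boundary le_in le_jn ip Dij.
have := back_count r bij; have := back_count r.+1 bij.
have := valid_nneg bP bij r0; have := valid_nneg bP bij (ltn0Sn r).
have := valid_dec bP bij r0; rewrite /bshape; lia.
Qed.

(** Induction from the boundary towards the origin.  If the outgoing labels of
    a square differ, the old shape is the intersection of two partitions.  If
    both equal [r + 1 > 1], one box was removed from part [r + 1], which leaves
    room to remove one from part [r]. *)
Lemma back_partition i j r : grid_point D i j -> i <= n -> j <= n -> 0 < r ->
  Z j r <= gshape back i j r /\
  gshape back i j r.+1 + Z j r <= gshape back i j r + Z j r.+1.
Proof.
have [s E] : exists s, n + n - (i + j) <= s by exists (n + n - (i + j)).
elim: s i j r E => [|s IH] i j r E ip le_in le_jn r0; case Dij: (D i j).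
- by have [_ _ _ _ [? ?]] := cell_grid_points Dij; lia.
- exact: back_partition_boundary.
- have [p11 p10 p01 _ [lt_in lt_jn]] := cell_grid_points Dij.
  have Z_S q : Z j q = (back j 0 == q) + Z j.+1 q by rewrite /Z big_ltn.
  have E10 : n + n - (i.+1 + j) <= s by lia.
  have E01 : n + n - (i + j.+1) <= s by lia.
  have {}p10 q : 0 < q -> _ := fun q0 => IH _ _ q E10 p10 lt_in le_jn q0.
  have {}p01 q : 0 < q -> _ := fun q0 => IH _ _ q E01 p01 le_in lt_jn q0.
  have Sr q := flow_gshapeSr back_flow i j q.
  have [p10a p10b] := p10 r r0; have [p10a' _] := p10 r.+1 (ltn0Sn r).
  have [p01a p01b] := p01 r r0; have [p01a' _] := p01 r.+1 (ltn0Sn r).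
  have E11 : n + n - (i.+1 + j.+1) <= s by lia.
  have [p11a p11b] := IH _ _ r E11 p11 lt_in lt_jn r0.
  have Eh : back i j.+1 = _ := back_flow.2 i j.
  move: p10a p10b p10a' p01a p01b p01a' p11a p11b (Sr r) (Sr r.+1) Eh.
  rewrite !gshapeSl !Z_S.
  case: (eqVneq (back i j) (back j i)) => [<-|ne]; last by lia.
  rewrite /cross Dij eqxx /=; case: (posnP (back i j)) => [->|]; rewrite ?orbT /=; lia.
- exact: back_partition_boundary.
Qed.

(** At a point of the vertical axis the corrected shape is minus the content of
    the axis labels below it, which is a partition only if there are none. *)
Lemma back0 i : i < n -> back i 0 = 0.
Proof.
move=> lt_in; apply/eqP; rewrite -leqn0 leqNgt; apply/negP => h0.
have i0 : grid_point D 0 i by [].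
have [/= + _] := back_partition i0 (leq0n n) (ltnW lt_in) h0.
by rewrite gshape0l /Z (big_ltn lt_in) eqxx.
Qed.

Lemma back0_all i : back i 0 = 0.
Proof.
case: (ltnP i n) => [/back0 //|le_ni].
have nD : ~~ D i 0 by apply/negP => /cell_lt; rewrite ltnNge le_ni.
rewrite -(flow_frozen back_flow nD (leq0n n)) back_far // nth_default //.
by rewrite (valid_size bP).
Qed.

Lemma back_label i j : back i j = label D back_bits i j.
Proof. by apply: label_unique; [apply: back0_all | apply: back_flow.2]. Qed.

Lemma back_grow i j k : j <= k -> back i j <= back i k.
Proof.
move/subnK <-; elim: (k - j) => [|m IH] //; rewrite addSn (leq_trans IH) //.
by rewrite back_flow.2 /cross; case: ifP => // _; lia.
Qed.

(** The label of a column starts at 0 and ends at a letter of [b], which is not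
    0; it becomes positive exactly at a 1 and then stays positive. *)
Lemma back_strans : sym_transversal D back_bits.
Proof.
split.
- exact: back_bitsC.
- by move=> i j /and3P[].
- suff lt_absurd i j j' : back_bits i j -> back_bits i j' -> j < j' -> False.
    move=> i j j' x1 x2; case: (ltngtP j j') => //.
      by move/(lt_absurd _ _ _ x1 x2).
    by move/(lt_absurd _ _ _ x2 x1).
  move=> /and3P[_ /eqP h1 _] /and3P[D' /eqP h2 /eqP h3] /(back_grow i).
  by rewrite h1 (backE i j') /uncross D' h2 h3.
- move=> i lt_in.
  have bi : 0 < back i n.
    rewrite back_far // lt0n; apply: contra (valid_pos bP) => /eqP <-.
    by rewrite mem_nth // (valid_size bP).
  elim: n bi => [|m IH]; first by rewrite back0_all.
  case: (posnP (back i m)) => [b0|/IH //].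
  rewrite back_flow.2 /cross b0; case: ifP => // _; rewrite orbF.
  by case x0: (back_bits i m) => // _; exists m.
Qed.

Lemma back_word : word n D back_bits = b.
Proof.
rewrite /word -[RHS](mkseq_nth 0) (valid_size bP).
by apply/eq_mkseq => k; rewrite -back_label back_far.
Qed.

End Backward.

Lemma valid_realized n (D : sym_diagram n) b : valid D b ->
  exists2 x, sym_transversal D x & word n D x = b.
Proof. by move=> bP; exists (back_bits D b); [apply: back_strans | apply: back_word]. Qed.

(** The local rule is reversible, so the bits can be recomputed from the final
    labels. *)
Lemma word_inj n (D : sym_diagram n) x y : sym_transversal D x -> sym_transversal D y ->
  word n D x = word n D y -> x =2 y.
Proof.
suff recover z : sym_transversal D z -> z =2 back_bits D (word n D z).
  by move=> xP yP E i j; rewrite (recover x) // (recover y) // E.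
move=> zP.
have zC : forall i j, z j i = z i j by move=> i j; rewrite (transvC zP).
have uncross_label i j : label D z i j = uncross (D i j) (label D z i j.+1) (label D z j i.+1).
  rewrite !labelS (cellC D j i) (zC i j) /cross /uncross.
  case Dij: (D i j) => //=; case zij: (z i j).
    have zji : z j i by rewrite zC.
    by rewrite (label_before zP zij) (label_before zP zji).
  case: (eqVneq (label D z i j) (label D z j i)) => [->|ne]; last by rewrite (negPf ne).
  by rewrite !eqxx /=; case: (label D z j i) => // m; rewrite addn1.
have label_far i j : n <= j -> label D z i j = nth 0 (word n D z) i.
  move=> le_nj; have nD k : n <= k -> ~~ D i k.
    by move=> le_nk; rewrite cellC; apply/negP => /cell_lt; rewrite ltnNge le_nk.
  case: (ltnP i n) => [lt_in|le_ni].
    by rewrite nth_mkseq // (flow_frozen (label_flow zP) (nD _ (leqnn n)) le_nj).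
  rewrite nth_default ?size_mkseq // -(label0 D z i).
  have nD0 : ~~ D i 0 by apply/negP => /cell_lt; rewrite ltnNge le_ni.
  exact: (flow_frozen (label_flow zP) nD0 (leq0n j)).
have labelE i j : label D z i j = back D (word n D z) i j.
  have [s le_s] : exists s, n - i + (n - j) <= s by exists (n - i + (n - j)).
  elim: s i j le_s => [|s IH] i j le_s.
    have le_nj : n <= j by lia.
    by rewrite label_far // back_far.
  case: (leqP n j) => [le_nj|lt_jn]; first by rewrite label_far // back_far.
  rewrite uncross_label backE; case Dij: (D i j); last first.
    by rewrite /uncross /=; apply: IH; lia.
  by rewrite !IH //; have := cell_lt Dij; lia.
move=> i j; rewrite /back_bits -!labelE; apply/idP/and3P => [zij|[Dij]].
  have zji : z j i by rewrite zC.
  by rewrite (transv_cell zP zij) (label_at zP zij) (label_at zP zji).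
rewrite !labelS (cellC D j i) (zC i j) /cross Dij /=; case: (z i j) => //=.
case: (eqVneq (label D z i j) (label D z j i)) => [->|ne].
  by rewrite ?eqxx; case: (label D z j i) => [|m] //=; rewrite ?addn1.
by rewrite ?(negPf ne) => /eqP a1 /eqP b1; rewrite a1 b1 eqxx in ne.
Qed.

(** * Increasing and decreasing chains *)

Definition inc (p q : nat * nat) := (p.1 < q.1) && (p.2 < q.2).
Definition dec (p q : nat * nat) := (p.1 < q.1) && (q.2 < p.2).

Lemma inc_trans : transitive inc.
Proof. by move=> [a b] [c d] [e f]; rewrite /inc /=; lia. Qed.

Definition inrect (P : nat -> nat -> bool) i j (p : nat * nat) :=
  [&& p.1 < i, p.2 < j & P p.1 p.2].

Section Chains.
Variables (n : nat) (D : sym_diagram n) (x : nat -> nat -> bool).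
Hypothesis xP : sym_transversal D x.
Local Notation h := (label D x).
Local Notation gshape := (gshape h).

Lemma gshape_mono i j i' j' r : 0 < r -> i <= i' -> j <= j' ->
  gshape i j r <= gshape i' j' r.
Proof.
move=> r0 /subnKC <- /subnKC <-.
elim: (j' - j) => [|m IH]; last by rewrite addnS (gshapeSr xP) // (leq_trans IH) ?leq_addr.
rewrite addn0; elim: (i' - i) => [|m IH]; first by rewrite addn0.
by rewrite addnS gshapeSl (leq_trans IH) ?leq_addr.
Qed.

Lemma inrectD i j p P : grid_point D i j -> inrect P i j p -> D p.1 p.2.
Proof.
move=> ip /and3P[]; case: i j ip => [|i] [|j] // Dij pi pj _.
have {}Dij : D i j := Dij.
by apply: cell_down Dij; rewrite -ltnS.
Qed.

(** A 1 at [(a, b)] makes the first part larger at [(a + 1, b + 1)] than at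
    [(a, b)]. *)
Lemma inc_chain_gshape i j s :
  sorted inc s -> all (inrect x i j) s -> size s <= gshape i j 1.
Proof.
rewrite (sorted_pairwise inc_trans).
elim/last_ind: s i j => [|s [a b] IH] i j //.
rewrite pairwise_rcons all_rcons size_rcons.
move=> /andP[/allP lt_s ps] /andP[/and3P[/= ai bj xab] /allP xs].
have le_s : size s <= gshape a b 1.
  apply: IH => //; apply/allP => p ps'; case/and3P: (xs p ps') => _ _ xp.
  by case/andP: (lt_s p ps') => /= ? ?; apply/and3P.
apply: leq_ltn_trans le_s _; apply: leq_trans (@gshape_mono a.+1 b.+1 i j 1 _ _ _) => //.
have xba : x b a by rewrite (transvC xP).
by rewrite gshapeSl (gshapeSr xP) // (label_at xP xab) addn1 ltnS leq_addr.
Qed.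

(** The squares where two labels [r] start.  For [r = 1] they are the 1s of the
    transversal; in general they form its [r - 1]-st iterated skeleton in
    Viennot's geometric construction. *)
Definition corner r i j := [&& D i j, h i j.+1 == r & h j i.+1 == r].

Lemma cornerC r i j : corner r i j = corner r j i.
Proof. by rewrite /corner cellC; case: (D j i) => //=; rewrite andbC. Qed.

Lemma corner1 i j : corner 1 i j = x i j.
Proof.
apply/idP/idP => [/and3P[Dij]|xij]; last first.
  have xji : x j i by rewrite (transvC xP).
  by rewrite /corner (transv_cell xP xij) (label_at xP xij) (label_at xP xji).
rewrite !labelS (cellC D j i) (transvC xP j i) /cross Dij /=.
case: (x i j) => //; case: (eqVneq (h i j) (h j i)) => [->|/[swap] /eqP -> /[swap] /eqP ->] //.
by case: (h j i) => [|?] //; rewrite addn1.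
Qed.

(** Move towards the origin as long as the first part allows it.  When it drops
    in both directions, both outgoing labels are 1, and the square holds the
    last point of the chain. *)
Lemma gshape_inc_chain i j k : grid_point D i j -> k <= gshape i j 1 ->
  exists s, [/\ sorted inc s, all (inrect x i j) s & size s = k].
Proof.
have [m le_m] : exists m, i + j <= m by exists (i + j).
elim: m i j k le_m => [|m IH] [|i] [|j] [|k] le_m ip le_k; try by exists [::].
- by rewrite gshape0l in le_k.
- by rewrite gshape0l in le_k.
- by rewrite gshape0l in le_k.
- by rewrite (gshape0r xP) in le_k.
have widen i' j' s : i' <= i.+1 -> j' <= j.+1 ->
    all (inrect x i' j') s -> all (inrect x i.+1 j.+1) s.
  move=> li lj; apply: sub_all => p /and3P[p1 p2 p3].
  by apply/and3P; split=> //; [apply: leq_trans p1 li | apply: leq_trans p2 lj].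
have [_ p10 p01 p00 _] := cell_grid_points (ip : D i j).
case: (ltnP k (gshape i j.+1 1)) => [lt1|ge1].
  have [|s [s1 s2 s3]] := IH i j.+1 k.+1 _ p01 lt1; first by lia.
  by exists s; split=> //; apply: widen s2.
case: (ltnP k (gshape i.+1 j 1)) => [lt1|ge2].
  have [|s [s1 s2 s3]] := IH i.+1 j k.+1 _ p10 lt1; first by lia.
  by exists s; split=> //; apply: widen s2.
have B1 := gshapeSl h i j.+1 1.
have B2 := gshapeSr xP i.+1 j (ltnSn 0).
have B3 := gshapeSl h i j 1.
have h1 : h i j.+1 == 1 by lia.
have h2 : h j i.+1 == 1 by lia.
have xij : x i j by rewrite -corner1; apply/and3P.
have h3 := label_before xP xij.
have [||s [s1 s2 s3]] := IH i j k _ p00; [by lia | by move: B1 B2 B3; rewrite h3; lia |].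
exists (rcons s (i, j)); rewrite size_rcons s3 all_rcons; split=> //.
  move: s1; rewrite !(sorted_pairwise inc_trans) pairwise_rcons => ->; rewrite andbT.
  by apply: sub_all s2 => p /and3P[p1 p2 _]; apply/andP.
by rewrite (widen i j) // andbT; apply/and3P.
Qed.

Lemma corner_intro r i j : 0 < r -> D i j -> h i j = r -> h j i = r -> corner r.+1 i j.
Proof.
move=> r0 Dij e1 e2; rewrite /corner !labelS (cellC D j i) /cross Dij e1 e2 eqxx r0 !orbT.
by rewrite addn1 eqxx.
Qed.

Lemma corner_inputs r i j : 0 < r -> corner r.+1 i j -> h i j = r /\ h j i = r.
Proof.
move=> r0; rewrite /corner !labelS (cellC D j i) (transvC xP j i) /cross.
case: (D i j) => //=; case: (eqVneq (h i j) (h j i)) => [->|/[swap]]; rewrite ?eqxx.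
  by move=> /andP[/eqP + _]; case: (x i j) (h j i) => [] [|?] //=; lia.
by move=> /andP[/eqP -> /eqP ->]; rewrite eqxx.
Qed.

(** A label changes only where it meets its equal. *)
Lemma label_run r i j m : 0 < r -> h i j = r -> j <= m ->
  h i m = r \/ exists k, [/\ j <= k, k < m & corner r.+1 i k].
Proof.
move=> r0 hr; elim: m => [|m IH]; first by rewrite leqn0 => /eqP <-; left.
rewrite leq_eqVlt => /orP[/eqP <-|]; [by left | rewrite ltnS => le_jm].
have [hm|[k [? ? ?]]] := IH le_jm; last by right; exists k; split=> //; lia.
case E: (D i m && (r == h m i)).
  by case/andP: E => Dim /eqP E; right; exists m; split=> //; apply: corner_intro.
by left; rewrite labelS /cross hm E.
Qed.

Lemma label_birth r i j : 0 < r -> h i j = r ->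
  exists k, [/\ k < j, corner r i k & forall m, k < m <= j -> h i m = r].
Proof.
move=> r0; elim: j => [|j IH]; first by rewrite label0 => E; rewrite -E in r0.
move=> hr; case Xij: (corner r i j).
  exists j; split=> // m /andP[l1 l2]; have -> : m = j.+1 by lia.
  by [].
have hj : h i j = r.
  move: hr Xij; rewrite /corner !labelS (cellC D j i) (transvC xP j i) /cross.
  case: (D i j) => //=; case: (eqVneq (h i j) (h j i)) => [<-|_] //.
  by move=> E; rewrite ?E !eqxx.
have [k [l1 l2 l3]] := IH hj; exists k; split=> //; first by lia.
by move=> m /andP[l4]; rewrite leq_eqVlt => /orP[/eqP -> //|l5]; apply: l3; lia.
Qed.

(** The label [r] leaving [p] along its row and the one leaving [q] down its
    column head for the common square [(q.1, p.2)]: they meet there, unless one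
    of them has met another label [r] before. *)
Lemma dec_gap r p q : 0 < r -> corner r p.1 p.2 -> corner r q.1 q.2 -> dec p q -> D q.1 p.2 ->
  exists z, [/\ corner r.+1 z.1 z.2, p.1 < z.1 <= q.1 & q.2 < z.2 <= p.2].
Proof.
case: p q => [a b] [c d] /= r0 /and3P[_ _ /eqP e1] /and3P[_ /eqP e2 _] /andP[/= ac db] Dcb.
have [hb|[k [l1 l2 Xk]]] := label_run r0 e1 ac; last first.
  by exists (k, b); rewrite cornerC /= l1 (ltnW l2) db leqnn.
have [hc|[k [l1 l2 Xk]]] := label_run r0 e2 db; last first.
  by exists (c, k); rewrite /= ac leqnn l1 (ltnW l2).
by exists (c, b); rewrite /= ac db !leqnn; split=> //; apply: corner_intro.
Qed.

(** [dec_gap] puts a corner of the next order between any two neighbours.  The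
    new path starts from [(p.1, p.2.+1)] because the second coordinate of its
    first point may equal [p.2]. *)
Lemma dec_path_up r i j p s : grid_point D i j -> 0 < r -> path dec p s ->
  all (inrect (corner r) i j) (p :: s) ->
  exists t, [/\ path dec (p.1, p.2.+1) t, all (inrect (corner r.+1) i j) t & size t = size s].
Proof.
move=> ip r0; elim: s p => [|q s IH] p; first by exists [::].
move=> /= /andP[pq qs] /and3P[rp rq rs].
have [|t [t1 t2 t3]] := IH q qs; first by rewrite /= rq.
have /and3P[pi pj Xp] := rp; have /and3P[qi qj Xq] := rq.
have Dqp : D q.1 p.2.
  by apply: (@inrectD i j (q.1, p.2) (fun _ _ => true)); rewrite // /inrect /= qi pj.
have [z [Xz /andP[pz1 zq1] /andP[qz2 zp2]]] := dec_gap r0 Xp Xq pq Dqp.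
have Rz : inrect (corner r.+1) i j z.
  by rewrite /inrect Xz (leq_ltn_trans zq1 qi) (leq_ltn_trans zp2 pj).
exists (z :: t); rewrite /= Rz t2 t3; split=> //.
rewrite /dec /= pz1 ltnS zp2 /=.
case: t t1 {t2 t3} => //= y t /andP[/andP[/= y1 y2] ->]; rewrite andbT /dec.
by rewrite (leq_ltn_trans zq1 y1) (leq_ltn_trans _ qz2).
Qed.

(** Passing to corners of the next order costs one point each time, so that a
    decreasing chain of length [k] leaves a corner of order [k]. *)
Lemma dec_chain_gshape i j s : grid_point D i j -> 0 < size s ->
  sorted dec s -> all (inrect x i j) s -> 0 < gshape i j (size s).
Proof.
case: s => [|p s] // ip _ ds.
have eqX : all (inrect x i j) (p :: s) = all (inrect (corner 1) i j) (p :: s).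
  by apply: eq_all => q; rewrite /inrect corner1.
suff H m q t r : size t = m -> path dec q t -> 0 < r ->
    all (inrect (corner r) i j) (q :: t) -> 0 < gshape i j (m + r).
  by rewrite eqX => /(H _ p s 1 erefl ds isT); rewrite addn1.
elim: m q t r => [|m IH] q t r st dt r0 al.
  have /andP[/and3P[l1 l2 /and3P[_ /eqP E _]] _] := al.
  rewrite add0n; apply: leq_trans (gshape_mono r0 l1 l2).
  by rewrite gshapeSl E eqxx addn1.
have [[|z u] [t1 t2 t3]] := dec_path_up ip r0 dt al; first by rewrite -t3 in st.
rewrite addSnnS; apply: (IH z u) => //; first by move: t3; rewrite st => -[].
by case/andP: t1.
Qed.

(** [(k, q.2)] is the corner where the label [r] entering [q] along its row
    started.  With the coordinates of [q] exchanged, this describes the label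
    entering along the column. *)
Definition birth r (q : nat * nat) k :=
  [/\ k < q.1, corner r k q.2 & forall m, k < m <= q.1 -> h q.2 m = r].

(** Between its birth and [q] the label meets no other label [r], so the [r]-th
    part is constant along that stretch of the row. *)
Lemma birth_gshape r q k : 0 < r -> D q.1 q.2 -> birth r q k ->
  gshape k.+1 q.2.+1 r = (gshape q.1 q.2 r).+1.
Proof.
case: q => a b r0 /= Dab [/= ka Xk hk].
have hk1 : h b k.+1 = r by apply: hk; rewrite ltnSn.
rewrite (gshapeSr xP) // hk1 eqxx addn1; congr S.
suff H m : k < m -> m <= a -> gshape k.+1 b r = gshape m b r by apply: H.
elim: m => // m IH; rewrite ltnS leq_eqVlt => /orP[/eqP -> //|lt_km] lt_ma.
rewrite (gshapeSl _ m) -(IH lt_km (ltnW lt_ma)); case: eqP; last by rewrite addn0.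
move=> hm; have hb : h b m = r by apply: hk; rewrite lt_km ltnW.
have Dmb : D m b by apply: cell_down Dab => //; apply: ltnW.
have /and3P[_ _ /eqP] := corner_intro r0 Dmb hm hb.
have -> : h b m.+1 = r by apply: hk; rewrite lt_ma ltnW.
by move/n_Sn.
Qed.

Lemma birth_col r q : 0 < r -> corner r.+1 q.1 q.2 -> exists k, birth r (q.2, q.1) k.
Proof.
move=> r0 /(corner_inputs r0)[e1 e2]; have [k [l1 l2 l3]] := label_birth r0 e1.
by exists k; split=> //=; rewrite cornerC.
Qed.

Lemma birth_row r q : 0 < r -> corner r.+1 q.1 q.2 -> exists k, birth r q k.
Proof. by case: q => a b r0; rewrite /= cornerC => /(birth_col (q := (b, a)) r0). Qed.

(** A corner [q] of order [r + 1] arises from two corners of order [r]: one, [a],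
    in its row and one, [b], in its column.  Let [c] be the [r]-th part of the
    shape at [q], and let [q2] be the next corner of the chain, with [a2], [b2]
    and [c2].  If [c <= c2] then [a2] is not on the left of [b], so that [a],
    [a2] is decreasing; if [c2 < c] then [b] is in a row below that of [a2], so
    that [b] can be followed by [b2].  Taking the [a]-corners while [c] grows
    and the [b]-corners while it drops, one uses both at a local maximum of [c]
    and none at a local minimum.  If a smaller
    value is imagined before and after the chain, [c] has one more local maximum
    than local minima, so one point is gained in total.  The first conclusion is
    this chain, which starts at [a]; the second, for an arrival at [q] by a drop,
    has only as many points as there are corners and may start at [b]. *)
Lemma dec_path_down r i j q s : grid_point D i j -> 0 < r -> path dec q s ->
  all (inrect (corner r.+1) i j) (q :: s) ->
  (forall k, birth r q k -> exists t,
     [/\ path dec (k, q.2) t, all (inrect (corner r) i j) t & size t = (size s).+1]) /\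
  (exists f t, [/\ path dec f t, all (inrect (corner r) i j) (f :: t), size t = size s,
     q.1 <= f.1 & f.2 < q.2]).
Proof.
move=> ip r0; elim: s q => [|q2 s IH] q.
  move=> _ /= /andP[/and3P[q1 q2 Xq] _].
  have [kb [lb Xb _]] := birth_col r0 Xq.
  have Rb : inrect (corner r) i j (q.1, kb).
    by rewrite /inrect /= q1 cornerC Xb (ltn_trans lb q2).
  split; last by exists (q.1, kb), [::]; rewrite /= Rb.
  move=> ka [la _ _]; exists [:: (q.1, kb)]; rewrite /= Rb /dec /=; split=> //.
  by rewrite la lb.
move=> /= /andP[/andP[lt1 lt2] qs] /and3P[Rq Rq2 Rs].
have [|E1 [f [t [ft fR ts f1 f2]]]] := IH q2 qs; first by rewrite /= Rq2.
have /and3P[qi qj Xq] := Rq; have /and3P[q2i q2j Xq2] := Rq2.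
have [kb Bb] := birth_col r0 Xq; have [lb Xb _] := Bb; rewrite /= in lb Xb.
have [ka2 Ba2] := birth_row r0 Xq2.
have Rb : inrect (corner r) i j (q.1, kb) by rewrite /inrect /= qi cornerC Xb (ltn_trans lb qj).
have Dq : D q.2 q.1 by rewrite cellC; apply: inrectD ip Rq.
have Dq2 := inrectD ip Rq2.
have Sb := birth_gshape (q := (q.2, q.1)) r0 Dq Bb; rewrite /= in Sb.
have Sa2 := birth_gshape r0 Dq2 Ba2.
have [t2 [t21 t22 t23]] := E1 _ Ba2.
have [la2 Xa2 ha2] := Ba2.
have Ra2 : inrect (corner r) i j (ka2, q2.2).
  by rewrite /inrect /= Xa2 q2j (ltn_trans la2 q2i).
(* In both cases a misplaced corner of order r would lie in a rectangle whose
   r-th part is too small for it, by birth_gshape and monotonicity. *)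
case: (leqP (gshape q.1 q.2 r) (gshape q2.1 q2.2 r)) => [le_c|lt_c].
  have le_k : q.1 <= ka2.
    rewrite leqNgt; apply/negP => lt_k.
    have := gshape_mono r0 (lt_k : ka2.+1 <= q.1) (lt2 : q2.2.+1 <= q.2).
    by rewrite Sa2 ltnNge le_c.
  split; last by exists (ka2, q2.2), t2; rewrite /= Ra2 t22 t23.
  move=> ka [la _ _]; exists ((ka2, q2.2) :: t2).
  by rewrite /= t21 Ra2 t22 t23 /dec /= (leq_trans la le_k) lt2.
have lt_k : q2.2 < kb.
  rewrite ltnNge; apply/negP => le_k.
  have := gshape_mono r0 (lt1 : q.1.+1 <= q2.1) (le_k : kb.+1 <= q2.2.+1).
  rewrite (gshapeC xP q.1.+1) // Sb (gshapeSr xP) // (gshapeC xP q.2) //.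
  by move: lt_c; clear; lia.
have bf : dec (q.1, kb) f.
  by rewrite /dec /= (leq_trans lt1 f1) (ltn_trans f2 lt_k).
split; last first.
  by exists (q.1, kb), (f :: t); move: fR; rewrite /= bf ft Rb ts => ->; rewrite leqnn.
move=> ka [la _ _]; exists [:: (q.1, kb), f & t].
by move: fR; rewrite /= bf ft Rb ts => ->; rewrite /dec /= la lb.
Qed.

(** A box in part [k] comes from a corner of order [k]; going down to the 1s of
    the transversal, one point is gained at each order. *)
Lemma gshape_dec_chain i j k : grid_point D i j -> 0 < k -> 0 < gshape i j k ->
  exists s, [/\ sorted dec s, all (inrect x i j) s & size s = k].
Proof.
move=> ip k0 sk.
suff H r m : 0 < r ->
    (exists q s, [/\ path dec q s, all (inrect (corner r) i j) (q :: s) & size s = m]) ->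
    exists q s, [/\ path dec q s, all (inrect (corner 1) i j) (q :: s) & size s = m + r.-1].
  have [a ai ha] : exists2 a, a < i & h a j = k.
    have : \sum_(a < i) (h a j == k) != 0 by rewrite -lt0n.
    rewrite sum_nat_eq0 negb_forall => /existsP[a]; rewrite implyTb eqb0 negbK => /eqP ha.
    by exists a.
  have [c [cj Xc _]] := label_birth k0 ha.
  have [|q [s [s1 s2 s3]]] := H k 0 k0.
    by exists (a, c), [::]; rewrite /= /inrect ai cj Xc.
  exists (q :: s); split=> //; last by rewrite /= s3 prednK.
  by rewrite (eq_all (a2 := inrect (corner 1) i j)) // => p; rewrite /inrect corner1.
elim: r m => [|[|r] IH] m // _ [q [s [s1 s2 s3]]].
  by exists q, s; rewrite addn0.
rewrite -[r.+2.-1]/r.+1 -addSnnS; apply: IH => //.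
have [E1 _] := dec_path_down ip (ltn0Sn r) s1 s2.
have /andP[/and3P[q1 q2 Xq] _] := s2.
have [ka Ba] := birth_row (ltn0Sn r) Xq; have [la Xa _] := Ba.
have [t [t1 t2 t3]] := E1 _ Ba.
exists (ka, q.2), t; rewrite t3 s3; split=> //.
by rewrite /= t2 andbT /inrect /= Xa q2 (ltn_trans la q1).
Qed.

End Chains.

(** * Ascents, column heights and the boundary path *)

Lemma crossE d x a b : cross d x a b = a + [&& d, a == b & x || (0 < a)].
Proof. by rewrite /cross; case: d; case: (a == b) => //=; rewrite addn0. Qed.

Definition flat (D : nat -> nat -> bool) i := forall j, D i j = D i.+1 j.

Section Ascents.
Variables (n : nat) (D : sym_diagram n) (x : nat -> nat -> bool).
Hypothesis xP : sym_transversal D x.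
Local Notation h := (label D x).

(** In each row the vertical label meets column [i] first and column [i + 1]
    next.  A raise of the second label by a vertical label that has just raised
    the first one, or that differs from it, cannot upset their order. *)
Lemma ascent_labels i j j' m : flat D i -> x i j -> x i.+1 j' -> j < j' ->
  h i.+1 m <= h i m.
Proof.
move=> fl xij xij' lt_j; elim: m => [|m IH]; first by rewrite label0.
have := labelS D x i m; have := labelS D x i.+1 m; have := labelS D x m i.
rewrite -fl (cellC D m i) (transvC xP m i) !crossE => Ev Eb Ea.
case Dim: (D i m); rewrite Dim /= in Ev Eb Ea; last by rewrite Ea Eb !addn0.
case x1: (x i m).
  have x1' : x m i by rewrite (transvC xP).
  have a0 := label_before xP x1; have v0 := label_before xP x1'.
  have x2 : x i.+1 m = false.
    apply/negP; rewrite (transvC xP) => x2.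
    by have /n_Sn := transv_inj xP x1' x2.
  move: IH Ev Eb Ea; rewrite a0 v0 x1 x2 /=.
  move: (h m i.+1) (h i.+1 m.+1) (h i m.+1) (h i.+1 m).
  by move=> v' b' a' b; clear; lia.
case x2: (x i.+1 m).
  have E := transv_inj xP x2 xij'; rewrite -E in lt_j.
  by rewrite (label_at xP x2) (label_after xP xij) // ltnW.
move: IH Ev Eb Ea; rewrite x1 x2 /=.
move: (h m i.+1) (h i.+1 m.+1) (h i m.+1) (h m i) (h i m) (h i.+1 m).
by move=> v' b' a' v a b; clear; lia.
Qed.

Lemma descent_labels i j j' m : flat D i -> x i j -> x i.+1 j' -> j' < j ->
  0 < h i m -> h i m < h i.+1 m.
Proof.
move=> fl xij xij' lt_j; elim: m => [|m IH]; first by rewrite label0.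
have := labelS D x i m; have := labelS D x i.+1 m; have := labelS D x m i.
rewrite -fl (cellC D m i) (transvC xP m i) !crossE => Ev Eb Ea.
case Dim: (D i m); rewrite Dim /= in Ev Eb Ea; last by rewrite Ea Eb !addn0.
case x1: (x i m).
  have x1' : x m i by rewrite (transvC xP).
  have a0 := label_before xP x1; have v0 := label_before xP x1'.
  have E := transv_inj xP x1 xij; rewrite -E in lt_j.
  have b0 := label_after xP xij' lt_j.
  move: Ev Eb Ea b0; rewrite a0 v0 x1 /=.
  move: (h m i.+1) (h i.+1 m.+1) (h i m.+1) (h i.+1 m) (x i.+1 m).
  by move=> v' b' a' b c; clear; lia.
case x2: (x i.+1 m).
  have E := transv_inj xP x2 xij'; rewrite -E in lt_j.
  case: (posnP (h i m.+1)) => [-> //|/(label_gt0_ex) [k lk xik]].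
  by rewrite (transv_inj xP xij xik) in lt_j; rewrite ltnNge lt_j in lk.
move: IH Ev Eb Ea; rewrite x1 x2 /=.
move: (h m i.+1) (h i.+1 m.+1) (h i m.+1) (h m i) (h i m) (h i.+1 m).
by move=> v' b' a' v a b; clear; lia.
Qed.

Lemma word_ascent i j j' : flat D i -> i.+1 < n -> x i j -> x i.+1 j' ->
  (j < j') = (nth 0 (word n D x) i.+1 <= nth 0 (word n D x) i).
Proof.
move=> fl lt_in xij xij'; rewrite !nth_mkseq ?(ltnW lt_in) //.
case: (ltngtP j j') => [lt_j|lt_j|E].
- by rewrite (ascent_labels n fl xij xij' lt_j).
- have lt_jn : j < n by have := transv_cell xP xij; rewrite cellC; apply: cell_lt.
  have := descent_labels fl xij xij' lt_j (label_after xP xij lt_jn).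
  by rewrite ltnNge => /negPf.
- have x1 : x j' i by rewrite -E (transvC xP).
  have x2 : x j' i.+1 by rewrite (transvC xP).
  by have := transv_inj xP x1 x2; lia.
Qed.

End Ascents.

Section Heights.
Variables (n : nat) (D : sym_diagram n).

Definition col_height i := find (fun j => ~~ D i j) (iota 0 n).

Lemma col_heightP i j : D i j = (j < col_height i).
Proof.
have le_n : col_height i <= n by rewrite -[X in _ <= X](size_iota 0 n) find_size.
case: (ltnP j (col_height i)) => [lt_j|le_j].
  have := before_find 0 lt_j; rewrite nth_iota ?(leq_trans lt_j) // add0n.
  by move/negbT; rewrite negbK.
apply/negP => Dij.
have lt_jn : j < n by move: Dij; rewrite cellC; apply: cell_lt.
have hasn : has (fun j => ~~ D i j) (iota 0 n).
  by rewrite has_find size_iota; apply: leq_ltn_trans lt_jn.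
have := nth_find 0 hasn; rewrite nth_iota ?add0n; last exact: leq_ltn_trans lt_jn.
by case/negP; apply: cell_down Dij.
Qed.

Lemma col_height_gt0 i : i < n -> 0 < col_height i.
Proof. by move/(cell_col D); rewrite col_heightP. Qed.

Lemma col_height_le i : col_height i <= n.
Proof. by rewrite -[X in _ <= X](size_iota 0 n) find_size. Qed.

Lemma boundary_left i : i < n -> boundary n D i (col_height i).
Proof.
move=> lt_in; rewrite /boundary ltnW // col_height_le col_heightP ltnn andbT /= /grid_point.
case: i lt_in => // i lt_in; rewrite (gtn_eqF (col_height_gt0 lt_in)) /=.
apply: (@cell_down _ D i.+1 (col_height i.+1).-1) => //.
by rewrite col_heightP prednK // col_height_gt0.
Qed.

Lemma boundary_right i : i < n -> boundary n D i.+1 (col_height i).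
Proof.
move=> lt_in; rewrite /boundary lt_in col_height_le /grid_point /=.
rewrite (gtn_eqF (col_height_gt0 lt_in)) /=.
rewrite col_heightP prednK ?col_height_gt0 // leqnn /=; apply/negP => D1.
have : D i (col_height i) by apply: cell_down D1.
by rewrite col_heightP ltnn.
Qed.

Lemma boundaryC i j : boundary n D i j = boundary n D j i.
Proof.
rewrite /boundary /grid_point (cellC D i j) (cellC D i.-1).
by rewrite andbA [(i <= n) && _]andbC -andbA orbCA.
Qed.

(** A walk along the boundary from its bottom left end [(0, n)], by column steps
    to the right and row steps upwards. *)
Lemma boundary_ind (P : nat -> nat -> Prop) :
  P 0 n ->
  (forall i, i < n -> P i (col_height i) -> P i.+1 (col_height i)) ->
  (forall j, j < n -> P (col_height j) j.+1 -> P (col_height j) j) ->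
  forall i j, boundary n D i j -> P i j.
Proof.
move=> P0 Pcol Prow i j.
have [m le_m] : exists m, i + (n - j) <= m by exists (i + (n - j)).
elim: m i j le_m => [|m IH] i j le_m bij; have /and4P[le_in le_jn ip nD] := bij.
  by have [-> ->] : i = 0 /\ j = n by lia.
case Eij: ((0 < i) && ~~ D i.-1 j).
  case: i {IH} (IH i.-1) le_m bij le_in ip nD Eij => // i IH le_m bij le_in ip nD /= nDi.
  have j0 : 0 < j.
    by rewrite lt0n; apply: contra nDi => /eqP ->; apply: cell_col.
  have E : j = col_height i.
    move: ip nDi; rewrite /grid_point /= (gtn_eqF j0) /= !col_heightP prednK // -leqNgt => A B.
    by apply/eqP; rewrite eqn_leq A B.
  rewrite E; apply: Pcol => //; rewrite -E; apply: IH; first by lia.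
  by rewrite E boundary_left.
case: (ltnP j n) => [lt_jn|le_nj]; last first.
  have Ej : j = n by apply/eqP; rewrite eqn_leq le_jn.
  case: (posnP i) => [i0|i0]; first by rewrite i0 Ej.
  by move/negbT: Eij; rewrite i0 /= negbK cellC => /cell_lt; rewrite ltnNge le_nj.
have E : i = col_height j.
  apply/eqP; rewrite eqn_leq; apply/andP; split.
    case: (posnP i) => [-> //|i0]; move/negbT: Eij; rewrite i0 /= negbK cellC col_heightP.
    by rewrite prednK.
  by move: nD; rewrite cellC col_heightP -leqNgt.
rewrite E; apply: Prow => //; rewrite -E; apply: IH; first by lia.
by rewrite E boundaryC boundary_right.
Qed.

End Heights.

(** * Conjugation of boundary words *)

Lemma count_iota_le m N : count (fun r => r <= m) (iota 1 N) = minn m N.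
Proof.
elim: N => [|N IH]; first by rewrite minn0.
rewrite -(addn1 N) iotaD count_cat IH /= addn0; lia.
Qed.

(** Content on the left minus content below, in a word of fixed total content,
    is symmetric in the two coordinates. *)
Lemma bshapeC b i j r : bshape b i j r = bshape b j i r.
Proof.
have Ei : count_mem r b = count_mem r (take i b) + count_mem r (drop i b).
  by rewrite -count_cat cat_take_drop.
have Ej : count_mem r b = count_mem r (take j b) + count_mem r (drop j b).
  by rewrite -count_cat cat_take_drop.
rewrite /bshape; lia.
Qed.

Section Conjugate.
Variables (n : nat) (D : sym_diagram n).

(** The box added by column [i] lies in row [nth 0 b i]; the letter of the new
    word is the column of that box. *)
Definition conj_word (b : seq nat) :=
  mkseq (fun i => bshape b i.+1 (col_height D i) (nth 0 b i)) n.

Section Fixed.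
Variable b : seq nat.
Hypothesis bP : valid D b.
Let szb := valid_size bP.

Lemma bshape_step i r : i < n -> 0 < r ->
  bshape b i.+1 (col_height D i) r = bshape b i (col_height D i) r + (nth 0 b i == r).
Proof.
move=> lt_in r0; rewrite /bshape (take_nth 0) ?szb // -cats1 count_cat /= addn0.
by rewrite addnBAC //; apply: (valid_nneg bP) => //; apply: boundary_left.
Qed.

Lemma letter_gt0 i : i < n -> 0 < nth 0 b i.
Proof.
move=> lt_in; rewrite lt0n; apply: contra (valid_pos bP) => /eqP <-.
by rewrite mem_nth // szb.
Qed.

Lemma letter_le r : r \in b -> r <= n + n.
Proof.
have [x xP <-] := valid_realized bP.
by case/mapP=> i; rewrite mem_iota => /andP[_ lt_in] ->; have := label_le_add D x i n; lia.
Qed.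

Lemma bshape_large i j r : n + n < r -> bshape b i j r = 0.
Proof.
move=> gt_r; apply/eqP; rewrite -leqn0 (leq_trans (leq_subr _ _)) // leqn0.
apply/eqP/count_memPn; apply: contraL gt_r => /mem_take rb.
by rewrite -leqNgt letter_le.
Qed.

Lemma bshape_le i j r s : boundary n D i j -> 0 < r -> r <= s -> bshape b i j s <= bshape b i j r.
Proof.
move=> bij r0 /subnK <-; elim: (s - r) => [|m IH] //.
by rewrite addSn (leq_trans _ IH) // (valid_dec bP) // addn_gt0 r0 orbT.
Qed.

(** The [c]-th part of the conjugate of a boundary shape; no letter exceeds
    [n + n]. *)
Definition conj_bshape i j c := count (fun r => c <= bshape b i j r) (iota 1 (n + n)).

Lemma conj_bshape_step i c : i < n -> 0 < c ->
  conj_bshape i.+1 (col_height D i) c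
    = conj_bshape i (col_height D i) c + (nth 0 (conj_word b) i == c).
Proof.
move=> lt_in c0; rewrite nth_mkseq // /conj_bshape.
set a := nth 0 b i.
have a0 : 0 < a by apply: letter_gt0.
have a_in : a \in iota 1 (n + n).
  by rewrite mem_iota a0 add1n ltnS letter_le // mem_nth // szb.
have := perm_to_rem a_in; move/seq.permP => E; rewrite !E /=.
have -> : count (fun r => c <= bshape b i.+1 (col_height D i) r) (rem a (iota 1 (n + n)))
    = count (fun r => c <= bshape b i (col_height D i) r) (rem a (iota 1 (n + n))).
  apply: eq_in_count => r; rewrite (rem_filter _ (iota_uniq _ _)) mem_filter mem_iota.
  move=> /and3P[/= ne r0 _]; rewrite bshape_step // -/a eq_sym (negPf ne) addn0.
  by [].
rewrite bshape_step // -/a eqxx addnAC; congr (_ + _).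
by move: (bshape _ _ _ _) => m; clear; lia.
Qed.

Lemma conj_bshapeC i j c : conj_bshape i j c = conj_bshape j i c.
Proof. by apply: eq_count => r; rewrite bshapeC. Qed.

Lemma conj_word_count i j c : boundary n D i j -> 0 < c ->
  count_mem c (take i (conj_word b)) = conj_bshape i j c + count_mem c (drop j (conj_word b)).
Proof.
move=> bij c0; move: i j bij; apply: boundary_ind.
- rewrite take0 drop_oversize ?size_mkseq // /conj_bshape addn0 /=.
  rewrite (eq_count (a2 := pred0)) ?count_pred0 //.
  by move=> r; rewrite /bshape take0 /= sub0n leqNgt c0.
- move=> i lt_in E; rewrite (take_nth 0) ?size_mkseq // -cats1 count_cat /= E addn0.
  by rewrite conj_bshape_step // addnAC.
- move=> j lt_jn E; rewrite (drop_nth 0) ?size_mkseq //= E.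
  by rewrite (conj_bshapeC _ j.+1) (conj_bshapeC _ j) conj_bshape_step // addnA.
Qed.

Lemma conj_word_bshape i j c : boundary n D i j -> 0 < c ->
  bshape (conj_word b) i j c = conj_bshape i j c.
Proof. by move=> bij c0; rewrite /bshape (conj_word_count bij c0) addnK. Qed.

Lemma conj_word_valid : valid D (conj_word b).
Proof.
split.
- by rewrite size_mkseq.
- apply/negP => /mapP[i]; rewrite mem_iota => /andP[_ lt_in].
  by rewrite bshape_step ?letter_gt0 // eqxx addn1.
- by move=> i j c bij c0; rewrite (conj_word_count bij c0) leq_addl.
- move=> i j c bij c0; rewrite !conj_word_bshape //.
  by apply: sub_count => r; apply: ltnW.
Qed.

(** Removing the last box leaves a partition, so the parts at least as long as
    the part of this box are those which are not below it. *)
Lemma conj_bshape_letter i : i < n ->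
  conj_bshape i.+1 (col_height D i) (bshape b i.+1 (col_height D i) (nth 0 b i)) = nth 0 b i.
Proof.
move=> lt_in; set a := nth 0 b i; have a0 : 0 < a by apply: letter_gt0.
have le_a : a <= n + n by rewrite letter_le // mem_nth // szb.
rewrite /conj_bshape -[RHS](minn_idPl le_a) -count_iota_le.
apply: eq_in_count => r; rewrite mem_iota => /andP[r0 _].
apply/idP/idP => [|le_ra]; last first.
  exact: (bshape_le (boundary_right D lt_in) r0 le_ra).
apply: contraLR; rewrite -!ltnNge => lt_ar; rewrite !bshape_step // -/a eqxx.
rewrite (ltn_eqF lt_ar) addn0 addn1 ltnS.
exact: (bshape_le (boundary_left D lt_in) a0 (ltnW lt_ar)).
Qed.

(** Of two boxes added in turn, the second is weakly above the first if and only
    if it is strictly to its right. *)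
Lemma conj_word_descent i : flat D i -> i.+1 < n ->
  (nth 0 (conj_word b) i.+1 <= nth 0 (conj_word b) i) = ~~ (nth 0 b i.+1 <= nth 0 b i).
Proof.
move=> fl lt_in; have lt_i := ltnW lt_in; rewrite !nth_mkseq //.
have Eht : col_height D i.+1 = col_height D i by apply: eq_find => j; rewrite fl.
have a0 := letter_gt0 lt_i; have b0 := letter_gt0 lt_in.
have := bshape_step lt_in b0; rewrite Eht eqxx => ->.
rewrite !(bshape_step lt_i) // eqxx.
have bl := boundary_left D lt_i; have br := boundary_right D lt_i.
case: (leqP (nth 0 b i.+1) (nth 0 b i)) => /=; last first.
  move=> lt_ab; rewrite (ltn_eqF lt_ab).
  by have := bshape_le bl a0 (ltnW lt_ab); lia.
rewrite leq_eqVlt => /orP[/eqP ->|lt_ba]; first by rewrite eqxx; lia.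
rewrite (gtn_eqF lt_ba); have := bshape_le br b0 (ltnW lt_ba).
by rewrite !(bshape_step lt_i) // eqxx (gtn_eqF lt_ba); lia.
Qed.

End Fixed.

Lemma conj_wordK b : valid D b -> conj_word (conj_word b) = b.
Proof.
move=> bP; rewrite -[RHS](mkseq_nth 0) (valid_size bP) /conj_word.
apply/eq_in_map => i; rewrite mem_iota => /andP[_ lt_in].
rewrite -/(conj_word b) conj_word_bshape ?boundary_right // nth_mkseq ?conj_bshape_letter //.
by rewrite bshape_step ?letter_gt0 // eqxx addn1.
Qed.

Definition has_inc b k := exists i j, boundary n D i j /\ k <= bshape b i j 1.
Definition has_dec b k := exists i j, boundary n D i j /\ 0 < bshape b i j k.

Lemma has_dec_conj_word b k : valid D b -> 0 < k -> has_dec (conj_word b) k <-> has_inc b k.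
Proof.
move=> bP k0; split=> -[i [j [bij]]]; rewrite ?conj_word_bshape // => H; exists i, j; split=> //.
  move: H; rewrite -has_count => /hasP[r]; rewrite mem_iota => /andP[r0 _] le_k.
  exact: leq_trans le_k (bshape_le bP bij _ r0).
rewrite conj_word_bshape // -has_count; apply/hasP; exists 1 => //.
rewrite mem_iota /= add1n ltnS.
rewrite lt0n; apply/negP => /eqP n0.
by move: H; rewrite (bshape_large bP) ?n0 // leqNgt k0.
Qed.

End Conjugate.

(** * The Bender-Knuth involution on two decreasing blocks *)

(** Adding to the partition [nu] a box in each row listed by [u], one after the
    other, never leaves the set of partitions. *)
Definition lattice_from (nu : nat -> nat) (u : seq nat) := forall t r, 0 < r ->
  nu r.+1 + count_mem r.+1 (take t u) <= nu r + count_mem r (take t u).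

Lemma lattice_cat nu u v :
  lattice_from nu (u ++ v) <-> lattice_from nu u /\ lattice_from (fun r => nu r + count_mem r u) v.
Proof.
split=> [H|[Hu Hv] t r r0].
  split=> t r r0.
    have := H (minn t (size u)) r r0; rewrite takel_cat ?geq_minr //.
    by rewrite take_min take_size.
  have := H (size u + t) r r0; rewrite takeD take_size_cat // drop_size_cat //.
  by rewrite !count_cat !addnA.
case: (leqP t (size u)) => [le_t|lt_t]; first by rewrite takel_cat //; apply: Hu.
rewrite take_cat ltnNge (ltnW lt_t) /= !count_cat !addnA; exact: Hv.
Qed.

Lemma strip_lattice nu u :
  (forall r, 0 < r -> nu r.+1 + count_mem r.+1 u <= nu r) -> lattice_from nu u.
Proof.
move=> H t r r0; apply: leq_trans (leq_addr _ _); apply: leq_trans (H r r0).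
by rewrite leq_add2l -{2}(cat_take_drop t u) count_cat leq_addr.
Qed.

(** In a weakly decreasing word all letters [r + 1] come before the letters [r],
    so part [r] is still [nu r] when part [r + 1] has reached its final length:
    the boxes added form a horizontal strip. *)
Lemma lattice_strip nu u r : sorted geq u -> lattice_from nu u -> 0 < r ->
  nu r.+1 + count_mem r.+1 u <= nu r.
Proof.
elim: u nu => [|a u IH] nu su yu r0.
  by have := yu 0 r r0; rewrite /= !addn0.
have [y1 y2] := (lattice_cat nu [:: a] u).1 yu.
have {}IH := IH _ (path_sorted su) y2 r0; rewrite /= !addn0 in IH.
have y0 := yu 0 r r0; rewrite /= !addn0 in y0.
case: (eqVneq a r) => [E|ne]; last by move: IH; rewrite (negPf ne) /=; clear; lia.
rewrite /= E (_ : count_mem r.+1 u = 0); first by rewrite ltn_eqF //; lia.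
apply/count_memPn; apply/negP => ru.
have /allP/(_ _ ru) : all (geq a) u by apply: order_path_min su => ? ? ? /=; lia.
by rewrite /= E ltnn.
Qed.

Fixpoint dec_word N (k : nat -> nat) : seq nat :=
  if N is N'.+1 then nseq (k N) N ++ dec_word N' k else [::].

Lemma count_dec_word N k r : count_mem r (dec_word N k) = if 0 < r <= N then k r else 0.
Proof.
elim: N => [|N IH] /=; first by rewrite leqn0; case: r.
rewrite count_cat count_nseq IH /= eq_sym.
case: eqP => [->|/eqP ne]; first by rewrite ltnn leqnn mul1n addn0.
by rewrite mul0n add0n [r <= N.+1]leq_eqVlt (negPf ne) ltnS.
Qed.

Lemma dec_word_le N k : all (geq N) (dec_word N k).
Proof.
apply/allP => r; rewrite -has_pred1 has_count count_dec_word /=; by case: ifP => // /andP[].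
Qed.

Lemma geq_trans : transitive geq.
Proof. by move=> a b c /= ab bc; apply: leq_trans bc ab. Qed.

Lemma dec_word_sorted N k : sorted geq (dec_word N k).
Proof.
rewrite (sorted_pairwise geq_trans); elim: N => [|N IH] //=.
rewrite pairwise_cat IH andbT; apply/andP; split.
  apply/allrelP => a b; rewrite mem_nseq => /andP[_ /eqP ->] /(allP (dec_word_le N k)).
  by move=> /= le_b; apply: leqW.
by elim: (k N.+1) => //= m ->; rewrite andbT all_nseq /= leqnn orbT.
Qed.

Lemma eq_dec_word N k k' : (forall r, 0 < r <= N -> k r = k' r) -> dec_word N k = dec_word N k'.
Proof.
elim: N => [|N IH] //= H; rewrite H ?leqnn // IH // => r /andP[r0 le_r].
by apply: H; rewrite r0 leqW.
Qed.

Lemma dec_word_count N u : sorted geq u -> all (fun r => 0 < r <= N) u ->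
  dec_word N (fun r => count_mem r u) = u.
Proof.
move=> su /allP au; apply: (sorted_eq geq_trans) (dec_word_sorted _ _) su _.
  by move=> a b /=; rewrite -eqn_leq => /eqP.
rewrite /perm_eq; apply/allP => r _ /=; rewrite count_dec_word; case: ifP => // H.
by rewrite eq_sym; apply/eqP/count_memPn; apply: contraFN H => /au.
Qed.

Lemma size_sum_count N u : all (fun r => 0 < r <= N) u ->
  size u = \sum_(1 <= r < N.+1) count_mem r u.
Proof.
elim: u => [|a u IH] /=; first by rewrite big1.
move=> /andP[a0 /IH ->]; rewrite big_split /= -add1n; congr (_ + _).
rewrite (bigD1_seq a) ?iota_uniq ?mem_index_iota //= eqxx big1 // => r ne.
by rewrite eq_sym (negPf ne).
Qed.

Section BenderKnuth.
Variables (N : nat) (nu : nat -> nat).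
Hypothesis nuN : nu N.+1 = 0.

(** Let [rho] and [mu] be the shapes after [u1] and after [u2].  The two steps
    are horizontal strips if and only if each [rho r] lies between the maximum
    of [nu r] and [mu (r + 1)] and the minimum of [mu r] and [nu (r - 1)], or
    [mu 1] if [r = 1]: an interval that depends only on [nu] and [mu].  The new middle shape is the
    reflection of [rho] in these intervals. *)
Definition bk_mid (u1 u2 : seq nat) r :=
  let rho s := nu s + count_mem s u1 in
  let mu s := rho s + count_mem s u2 in
  maxn (nu r) (mu r.+1) + (if r == 1 then mu 1 else minn (mu r) (nu r.-1)) - rho r.

Definition bk1 u1 u2 := dec_word N (fun r => bk_mid u1 u2 r - nu r).
Definition bk2 u1 u2 :=
  dec_word N (fun r => nu r + count_mem r u1 + count_mem r u2 - bk_mid u1 u2 r).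

Section Facts.
Variables u1 u2 : seq nat.
Hypotheses (su1 : sorted geq u1) (su2 : sorted geq u2)
  (au1 : all (fun r => 0 < r <= N) u1) (au2 : all (fun r => 0 < r <= N) u2)
  (yu : lattice_from nu (u1 ++ u2)).
Let rho r := nu r + count_mem r u1.
Let mu r := rho r + count_mem r u2.
Let mid := bk_mid u1 u2.

Lemma strip1 r : 0 < r -> rho r.+1 <= nu r.
Proof. by apply: lattice_strip => //; case/lattice_cat: yu. Qed.

Lemma strip2 r : 0 < r -> mu r.+1 <= rho r.
Proof. by apply: lattice_strip => //; case/lattice_cat: yu. Qed.

Lemma mid_bounds r : 0 < r ->
  [/\ nu r <= mid r, mid r <= mu r, mid r.+1 <= nu r & mu r.+1 <= mid r].
Proof.
move=> r0; rewrite /mid /bk_mid -!/(rho _) -!/(mu _) /=.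
have := strip1 r0; have := strip2 r0; have := strip2 (ltn0Sn r).
have R1 : nu r <= rho r by apply: leq_addr.
have R2 : rho r <= mu r by apply: leq_addr.
have R3 : nu r.+1 <= rho r.+1 by apply: leq_addr.
have R4 : rho r.+1 <= mu r.+1 by apply: leq_addr.
case: r r0 R1 R2 R3 R4 => // r _ R1 R2 R3 R4 S1 S2 S3; rewrite !eqSS /=.
case: r R1 R2 R3 R4 S1 S2 S3 => [|r] R1 R2 R3 R4 S1 S2 S3 /=.
  by move: R1 R2 R3 R4 S1 S2 S3; clear; split; lia.
have := strip1 (ltn0Sn r).
by move: R1 R2 R3 R4 S1 S2 S3; clear; split; lia.
Qed.

Lemma mid_invol r : 0 < r -> mid r + rho r =
  maxn (nu r) (mu r.+1) + (if r == 1 then mu 1 else minn (mu r) (nu r.-1)).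
Proof.
move=> r0; rewrite /mid /bk_mid -!/(rho _) -!/(mu _) /= subnK //.
have := strip2 r0.
have R1 : nu r <= rho r by apply: leq_addr.
have R2 : rho r <= mu r by apply: leq_addr.
case: r r0 R1 R2 => // -[|r] _ R1 R2 S1 /=; first by move: R1 R2 S1; clear; lia.
have := strip1 (ltn0Sn r).
by move: R1 R2 S1; clear; lia.
Qed.

Lemma nu_large r : N < r -> nu r = 0.
Proof.
move/subnK <-; elim: (r - N.+1) => [|m IH] //; rewrite addSn.
have := strip1 (r := m + N.+1); rewrite addn_gt0 orbT IH => /(_ isT).
by rewrite /rho; clear; lia.
Qed.

Lemma count_large u r : all (fun s => 0 < s <= N) u -> N < r -> count_mem r u = 0.
Proof.
move=> /allP au lt_r; apply/count_memPn; apply/negP => /au.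
by rewrite [r <= N]leqNgt lt_r andbF.
Qed.

Lemma mid_large r : N < r -> mid r = 0.
Proof.
move=> lt_r; have r0 : 0 < r by apply: leq_trans lt_r.
have [_ + _ _] := mid_bounds r0.
by rewrite /mu /rho nu_large // !count_large // leqn0 => /eqP.
Qed.

Lemma count_bk1 r : 0 < r -> nu r + count_mem r (bk1 u1 u2) = mid r.
Proof.
move=> r0; rewrite count_dec_word r0 /=; case: leqP => [le_r|lt_r].
  by rewrite subnKC //; case: (mid_bounds r0).
by rewrite nu_large // mid_large.
Qed.

Lemma count_bk2 r : 0 < r -> mid r + count_mem r (bk2 u1 u2) = mu r.
Proof.
move=> r0; rewrite count_dec_word r0 /=; case: leqP => [le_r|lt_r].
  by rewrite subnKC //; case: (mid_bounds r0).
by rewrite mid_large // /mu /rho nu_large // !count_large.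
Qed.

Lemma count0_dec_word k : count_mem 0 (dec_word N k) = 0.
Proof. by rewrite count_dec_word. Qed.

Lemma bk_perm : perm_eq (bk1 u1 u2 ++ bk2 u1 u2) (u1 ++ u2).
Proof.
apply/allP => r _ /=; rewrite !count_cat; case: (posnP r) => [->|r0].
  rewrite !count0_dec_word eq_sym addn_eq0; apply/andP; split; apply/eqP/count_memPn.
    by apply/negP => /(allP au1).
  by apply/negP => /(allP au2).
apply/eqP; apply: (@addnI (nu r)).
by rewrite addnA count_bk1 // count_bk2 // /mu /rho addnA.
Qed.

Lemma bk_lattice : lattice_from nu (bk1 u1 u2 ++ bk2 u1 u2).
Proof.
apply/lattice_cat; split; apply: strip_lattice => r r0.
  by rewrite count_bk1 //; case: (mid_bounds r0).
by rewrite !count_bk1 // count_bk2 //; case: (mid_bounds r0).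
Qed.

Lemma dec_word_range k : all (fun r => 0 < r <= N) (dec_word N k).
Proof. by apply/allP => r; rewrite -has_pred1 has_count count_dec_word /=; case: ifP. Qed.

(** The lower end for [r] and the upper end for [r + 1] are the maximum and the
    minimum of the same two numbers.  So the old and the new middle shape have
    together as many boxes as [nu] and [mu], which means that the reflection
    exchanges the lengths of the two words. *)
Lemma bk_telescope M : 0 < M ->
  \sum_(1 <= r < M.+1) (mid r + rho r) + nu M
    = \sum_(1 <= r < M.+1) (nu r + mu r) + maxn (nu M) (mu M.+1).
Proof.
elim: M => // -[|M] IH _; first by rewrite !big_nat1 mid_invol //=; lia.
rewrite big_nat_recr //= [in RHS]big_nat_recr //= mid_invol //=.
by have := IH isT; lia.
Qed.

Lemma bk_size1 : size (bk1 u1 u2) = size u2.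
Proof.
case: (posnP N) => [N0|N0].
  by rewrite /bk1 N0 /=; move: au2; rewrite N0; case: (u2) => [|[|a] u].
have mu0 : mu N.+1 = 0 by rewrite /mu /rho nuN !count_large.
rewrite (size_sum_count (dec_word_range _)) (size_sum_count au2).
have := bk_telescope N0; rewrite mu0 maxn0 => /addIn E.
apply: (@addnI (\sum_(1 <= r < N.+1) (nu r + rho r))); rewrite -!big_split /=.
rewrite (eq_big_nat _ _ (F2 := fun r => mid r + rho r)); last first.
  by move=> r /andP[r0 _]; rewrite addnAC count_bk1.
by rewrite E; apply: eq_bigr => r _; rewrite /mu addnA.
Qed.

Lemma bk_size2 : size (bk2 u1 u2) = size u1.
Proof.
have := perm_size bk_perm; rewrite !size_cat bk_size1.
by rewrite addnC => /addIn.
Qed.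

Lemma bk_mid_bk r : 0 < r -> bk_mid (bk1 u1 u2) (bk2 u1 u2) r = rho r.
Proof.
move=> r0; have := mid_invol r0; rewrite /bk_mid.
rewrite (count_bk1 r0) (count_bk1 (ltn0Sn r)) (count_bk1 (ltn0Sn 0)).
by rewrite (count_bk2 r0) (count_bk2 (ltn0Sn r)) (count_bk2 (ltn0Sn 0)) => <-; rewrite addKn.
Qed.

End Facts.

Lemma bkK u1 u2 : sorted geq u1 -> sorted geq u2 ->
  all (fun r => 0 < r <= N) u1 -> all (fun r => 0 < r <= N) u2 ->
  lattice_from nu (u1 ++ u2) ->
  bk1 (bk1 u1 u2) (bk2 u1 u2) = u1 /\ bk2 (bk1 u1 u2) (bk2 u1 u2) = u2.
Proof.
move=> su1 su2 au1 au2 yu; split.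
  rewrite -[RHS](dec_word_count su1 au1); apply: eq_dec_word => r /andP[r0 _].
  by rewrite bk_mid_bk // addnC addnK.
rewrite -[RHS](dec_word_count su2 au2); apply: eq_dec_word => r /andP[r0 _].
by rewrite bk_mid_bk // count_bk1 // count_bk2 // addnC addnK.
Qed.

End BenderKnuth.

(** * Rewriting a word over a run of equal columns *)

Definition flat_seg (D : nat -> nat -> bool) i m := forall t, t.+1 < m -> flat D (i + t).

(** The boundary words of the symmetric transversals that avoid [I_k]. *)
Definition bounded_word n (D : sym_diagram n) k b :=
  valid D b /\ forall i j, boundary n D i j -> bshape b i j 1 < k.

(** In the word [p ++ u ++ q] the factor [u] belongs to columns of the same
    length [c].  Only the boundary points over these columns, and their mirror
    images, see the order of the letters of [u]. *)
Section Replace.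
Variables (n : nat) (D : sym_diagram n) (p u q : seq nat).
Let b := p ++ u ++ q.
Let i0 := size p.
Let c := col_height D i0.
Hypotheses (bP : valid D b) (u0 : 0 < size u) (fl : flat_seg D i0 (size u)).

Let le_n : i0 + size u <= n.
Proof. by rewrite -(valid_size bP) !size_cat leq_add2l leq_addr. Qed.

Lemma col_height_seg t : t < size u -> col_height D (i0 + t) = c.
Proof.
elim: t => [|t IH] lt_t; first by rewrite addn0.
rewrite addnS -IH ?(ltnW lt_t) //; apply: eq_find => j.
by rewrite -[RHS]negbK -[LHS]negbK !negbK (fl lt_t).
Qed.

Lemma seg_boundary t : t <= size u -> boundary n D (i0 + t) c.
Proof.
case: t => [_|t lt_t].
  by rewrite addn0; apply: boundary_left; apply: leq_trans le_n; rewrite -addn1 leq_add2l.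
rewrite addnS -(col_height_seg lt_t); apply: boundary_right.
by apply: leq_trans le_n; rewrite ltn_add2l.
Qed.

(** Otherwise columns [c - 1] and [c] would both have length [c], and the
    diagram would contain [(c, c - 1)] but not its mirror image. *)
Lemma seg_off_diagonal : c <= i0 \/ i0 + size u <= c.
Proof.
case: (leqP c i0) => [|lt1]; [by left | case: (leqP (i0 + size u) c) => [|lt2]; first by right].
have E1 : col_height D (i0 + (c.-1 - i0)) = c by apply: col_height_seg; lia.
have E2 : col_height D (i0 + (c - i0)) = c by apply: col_height_seg; lia.
rewrite subnKC in E1; last by lia.
rewrite subnKC in E2; last by lia.
have : D c c.-1 by rewrite col_heightP E2; lia.
by rewrite cellC col_heightP E1 ltnn.
Qed.

Lemma seg_inner i j : i0 < i < i0 + size u -> boundary n D i j -> j = c.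
Proof.
move=> /andP[lt1 lt2] /and4P[_ _ ip nD].
have E1 : col_height D (i0 + (i.-1 - i0)) = c by apply: col_height_seg; lia.
have E2 : col_height D (i0 + (i - i0)) = c by apply: col_height_seg; lia.
rewrite subnKC in E1; last by lia.
rewrite subnKC in E2; last by lia.
have c0 : 0 < c by rewrite -E2; apply: col_height_gt0; apply: leq_trans lt2 le_n.
move: nD; rewrite col_heightP E2 -leqNgt => le_cj.
apply/eqP; rewrite eqn_leq le_cj andbT.
have j0 : 0 < j by apply: leq_trans le_cj.
move: ip; rewrite /grid_point (gtn_eqF j0) (gtn_eqF (leq_ltn_trans (leq0n i0) lt1)) /=.
by rewrite col_heightP E1 prednK.
Qed.

Section New.
Variable u' : seq nat.
Hypothesis uu' : perm_eq u' u.
Let b' := p ++ u' ++ q.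
Let su : size u' = size u := perm_size uu'.

Lemma rep_count r : count_mem r b' = count_mem r b.
Proof. by rewrite !count_cat (seq.permP uu'). Qed.

Lemma rep_take i r : i <= i0 \/ i0 + size u <= i ->
  count_mem r (take i b') = count_mem r (take i b).
Proof.
case=> [le_i|le_i]; first by rewrite !takel_cat.
rewrite /b /b' !catA !take_cat !size_cat su -/i0 ltnNge le_i /=.
by rewrite !count_cat (seq.permP uu').
Qed.

Lemma rep_drop i r : i <= i0 \/ i0 + size u <= i ->
  count_mem r (drop i b') = count_mem r (drop i b).
Proof.
move=> le_i; apply: (@addnI (count_mem r (take i b'))).
by rewrite -count_cat cat_take_drop rep_take // -count_cat cat_take_drop rep_count.
Qed.

Lemma rep_seg t r : 0 < r -> t <= size u ->
  count_mem r (take (i0 + t) b')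
    = bshape b i0 c r + count_mem r (take t u') + count_mem r (drop c b').
Proof.
move=> r0 le_t; rewrite /b' takeD take_size_cat // drop_size_cat // takel_cat ?su //.
rewrite count_cat -/b' rep_drop; last exact: seg_off_diagonal.
have := seg_boundary (leq0n _); rewrite addn0 => /(valid_nneg bP)/(_ r0).
by rewrite addnAC /bshape take_size_cat // => /subnK ->.
Qed.

Lemma rep_bshape t r : 0 < r -> t <= size u ->
  bshape b' (i0 + t) c r = bshape b i0 c r + count_mem r (take t u').
Proof. by move=> r0 le_t; rewrite /bshape rep_seg // addnK. Qed.

Lemma rep_cases i j : boundary n D i j ->
  [\/ forall r, count_mem r (take i b') = count_mem r (take i b) /\
                count_mem r (drop j b') = count_mem r (drop j b),
      exists2 t, t <= size u & i = i0 + t /\ j = c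
    | exists2 t, t <= size u & j = i0 + t /\ i = c].
Proof.
move=> bij; have bji : boundary n D j i by rewrite boundaryC.
case Ei: (i0 < i < i0 + size u).
  constructor 2; exists (i - i0); first by lia.
  by rewrite subnKC ?(seg_inner Ei bij) //; lia.
case Ej: (i0 < j < i0 + size u).
  constructor 3; exists (j - i0); first by lia.
  by rewrite subnKC ?(seg_inner Ej bji) //; lia.
constructor 1 => r; rewrite rep_take ?rep_drop //; lia.
Qed.

(** The first part grows along the run, so its bound at the right end, where
    nothing has changed, holds at all points over the run. *)
Lemma rep_bounded k : lattice_from (bshape b i0 c) u' -> bounded_word D k b -> bounded_word D k b'.
Proof.
move=> yu [_ bk].
have sz' : size b' = n by rewrite -(valid_size bP) !size_cat su.
split; first split=> //.
- apply: contra (valid_pos bP); rewrite !mem_cat (perm_mem uu'); by [].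
- move=> i j r bij r0; case: (rep_cases bij) => [H|[t le_t [-> ->]]|[t le_t [Ej Ei]]].
  + by have [-> ->] := H r; apply: (valid_nneg bP).
  + by rewrite rep_seg // leq_addl.
  have := rep_seg r0 le_t; rewrite -Ej -Ei => E.
  have E1 : count_mem r b' = count_mem r (take i b') + count_mem r (drop i b').
    by rewrite -count_cat cat_take_drop.
  have E2 : count_mem r b' = count_mem r (take j b') + count_mem r (drop j b').
    by rewrite -count_cat cat_take_drop.
  by move: E E1 E2; lia.
- move=> i j r bij r0; case: (rep_cases bij) => [H|[t le_t [-> ->]]|[t le_t [-> ->]]].
  + rewrite /bshape; have [-> ->] := H r; have [-> ->] := H r.+1.
    exact: (valid_dec bP).
  + by rewrite !rep_bshape //; apply: yu.
  by rewrite !(bshapeC _ c) !rep_bshape //; apply: yu.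
have seg1 t : t <= size u -> bshape b' (i0 + t) c 1 < k.
  move=> le_t; rewrite rep_bshape //; apply: leq_ltn_trans (bk _ _ (seg_boundary (leqnn _))).
  have -> : bshape b (i0 + size u) c 1 = bshape b' (i0 + size u) c 1.
    by rewrite /bshape rep_take ?rep_drop //; [apply: seg_off_diagonal | right].
  rewrite rep_bshape // leq_add2l -su take_size.
  rewrite -[X in _ <= count_mem _ X](cat_take_drop t u') count_cat.
  exact: leq_addr.
move=> i j bij; case: (rep_cases bij) => [H|[t le_t [-> ->]]|[t le_t [-> ->]]].
- by rewrite /bshape; have [-> ->] := H 1; apply: bk.
- exact: seg1.
- by rewrite bshapeC; apply: seg1.
Qed.

End New.

Lemma seg_lattice : lattice_from (bshape b i0 c) u.
Proof.
move=> t r r0; case: (leqP t (size u)) => [le_t|lt_t]; last first.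
  rewrite take_oversize ?(ltnW lt_t) // -(take_size u).
  rewrite -!(rep_bshape (perm_refl u)) //; apply: (valid_dec bP) => //.
  exact: seg_boundary.
rewrite -!(rep_bshape (perm_refl u)) //; apply: (valid_dec bP) => //; exact: seg_boundary.
Qed.

End Replace.

(** * Reversing an ascent pattern *)

(** [true] stands for an ascent of the transversal, that is, a weak descent of
    the labels. *)
Definition has_ascent_word (w : seq bool) (u : seq nat) : bool :=
  if u is a :: s then pairmap (fun x y => y <= x) a s == w else false.

Lemma has_ascent_word_size w u : has_ascent_word w u -> size u = (size w).+1.
Proof. by case: u => //= a s /eqP <-; rewrite size_pairmap. Qed.

Lemma has_ascent_word_nseq k u : has_ascent_word (nseq k true) u = (size u == k.+1) && sorted geq u.
Proof.
case: u => //= a s; rewrite eqSS; elim: s a k => [|b s IH] a [|k] //=.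
by rewrite eqseq_cons IH eqSS eqb_id andbCA.
Qed.

Lemma has_ascent_word_cat w1 w2 u1 u2 :
  size u1 <= (size w1).+1 -> (size u1 <= size w1 -> u2 = [::]) ->
  (has_ascent_word w1 u1 && has_ascent_word w2 u2 : nat)
    = has_ascent_word (w1 ++ true :: w2) (u1 ++ u2)
      + has_ascent_word (w1 ++ false :: w2) (u1 ++ u2).
Proof.
have szF c : size (w1 ++ c :: w2) = (size w1 + size w2).+1 by rewrite size_cat addnS.
move=> le_u1 short; case: (ltngtP (size u1) (size w1).+1) le_u1 => // [lt_u1|E] _.
  have -> : u2 = [::] by apply: short.
  have F c : has_ascent_word (w1 ++ c :: w2) (u1 ++ [::]) = false.
    apply/negP => /has_ascent_word_size; rewrite szF cats0 => E; move: lt_u1; rewrite E; lia.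
  by rewrite !F andbF.
case: u1 E {short} => // a s [E]; case: u2 => [|b t].
  have F c : has_ascent_word (w1 ++ c :: w2) ((a :: s) ++ [::]) = false.
    by apply/negP => /has_ascent_word_size; rewrite szF cats0 /=; lia.
  by rewrite !F andbF.
rewrite /= pairmap_cat /= !eqseq_cat ?size_pairmap // !eqseq_cons.
by case: (_ == w1) => //=; case: (b <= _); case: (_ == w2).
Qed.

(** The word is cut into consecutive blocks, with a prescribed ascent word in
    each of them and no condition between one block and the next. *)
Fixpoint fits (C : seq (seq bool)) (b : seq nat) : bool :=
  if C is w :: C' then has_ascent_word w (take (size w).+1 b) && fits C' (drop (size w).+1 b)
  else b == [::].

Definition blocks_size (C : seq (seq bool)) := sumn [seq (size w).+1 | w <- C].

Lemma blocks_size_cat C1 C2 : blocks_size (C1 ++ C2) = blocks_size C1 + blocks_size C2.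
Proof. by rewrite /blocks_size map_cat sumn_cat. Qed.

Lemma fits_cat C1 C2 b :
  fits (C1 ++ C2) b = fits C1 (take (blocks_size C1) b) && fits C2 (drop (blocks_size C1) b).
Proof.
elim: C1 b => [|w C1 IH] b /=; first by rewrite take0 drop0.
rewrite IH drop_drop andbA (addnC (blocks_size C1)).
rewrite take_takel ?leq_addr // take_drop (addnC (blocks_size C1)).
by rewrite -[blocks_size (w :: C1)]/(_ + blocks_size C1).
Qed.

Lemma fits_size C b : fits C b -> size b = blocks_size C.
Proof.
elim: C b => [|w C IH] b /=; first by move/eqP ->.
move=> /andP[/has_ascent_word_size E /IH H]; rewrite -[b](cat_take_drop (size w).+1) size_cat E H.
by [].
Qed.

Lemma fits_split C1 C2 w1 w2 b :
  (fits (C1 ++ w1 :: w2 :: C2) b : nat)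
    = fits (C1 ++ (w1 ++ true :: w2) :: C2) b + fits (C1 ++ (w1 ++ false :: w2) :: C2) b.
Proof.
rewrite !fits_cat; case: (fits C1 _) => //=; set s := drop _ b.
have szF c : (size (w1 ++ c :: w2)).+1 = (size w1).+1 + (size w2).+1.
  by rewrite size_cat addSn.
rewrite !szF takeD drop_drop (addnC (size w2).+1).
set u1 := take _ s; set u2 := take _ (drop _ s).
have := @has_ascent_word_cat w1 w2 u1 u2.
have le1 : size u1 <= (size w1).+1 by rewrite size_take_min geq_minl.
move/(_ le1); have sh : size u1 <= size w1 -> u2 = [::].
  rewrite /u1 size_take; case: ltnP => [_|le_s _]; first by rewrite ltnn.
  by rewrite /u2 drop_oversize.
move/(_ sh) => E; rewrite andbA.
by case: (fits C2 _); rewrite ?andbT ?andbF.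
Qed.

Lemma eq_bk1 N nu nu' u1 u2 : nu =1 nu' -> bk1 N nu u1 u2 = bk1 N nu' u1 u2.
Proof. by move=> E; apply: eq_dec_word => r _; rewrite /bk_mid !E. Qed.

Lemma eq_bk2 N nu nu' u1 u2 : nu =1 nu' -> bk2 N nu u1 u2 = bk2 N nu' u1 u2.
Proof. by move=> E; apply: eq_dec_word => r _; rewrite /bk_mid !E. Qed.

Section Swap.
Variables (n : nat) (D : sym_diagram n) (k : nat).

Definition bkswap i m1 m2 b :=
  let nu := bshape b i (col_height D i) in
  let u1 := take m1 (drop i b) in
  let u2 := take m2 (drop (i + m1) b) in
  take i b ++ (bk1 (n + n) nu u1 u2 ++ bk2 (n + n) nu u1 u2) ++ drop (i + m1 + m2) b.

Lemma bkswapE p u1 u2 q :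
  let nu := bshape (p ++ (u1 ++ u2) ++ q) (size p) (col_height D (size p)) in
  bkswap (size p) (size u1) (size u2) (p ++ (u1 ++ u2) ++ q)
    = p ++ (bk1 (n + n) nu u1 u2 ++ bk2 (n + n) nu u1 u2) ++ q.
Proof.
move=> nu; rewrite /bkswap -/nu.
have -> : drop (size p + size u1) (p ++ (u1 ++ u2) ++ q) = u2 ++ q.
  by rewrite -catA catA drop_size_cat // size_cat.
have -> : drop (size p + size u1 + size u2) (p ++ (u1 ++ u2) ++ q) = q.
  by rewrite catA drop_size_cat // !size_cat addnA.
by rewrite drop_size_cat // -catA !take_size_cat.
Qed.

Lemma bkswapP C1 C2 a a' b : let i := blocks_size C1 in
  bounded_word D k b -> flat_seg D i (a.+1 + a'.+1) ->
  fits (C1 ++ nseq a true :: nseq a' true :: C2) b ->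
  let b' := bkswap i a.+1 a'.+1 b in
  [/\ bounded_word D k b', fits (C1 ++ nseq a' true :: nseq a true :: C2) b'
    & bkswap i a'.+1 a.+1 b' = b].
Proof.
move=> i bg fl; rewrite !fits_cat /= !size_nseq !has_ascent_word_nseq -/i.
set p := take i b; set u1 := take _ (drop i b); set u2 := take _ (drop a.+1 _).
set q := drop a'.+1 _ => /and3P[sp /andP[/eqP z1 s1] /andP[/andP[/eqP z2 s2] sq]].
have Eb : b = p ++ (u1 ++ u2) ++ q.
  rewrite /p -{1}(cat_take_drop i b); congr (_ ++ _).
  rewrite -(cat_take_drop a.+1 (drop i b)) -/u1 -catA; congr (_ ++ _).
  by rewrite -(cat_take_drop a'.+1 (drop a.+1 _)) -/u2 -/q.
have zp : size p = i by apply: fits_size.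
have bP := bg.1; rewrite Eb in bP bg.
have zu : size (u1 ++ u2) = a.+1 + a'.+1 by rewrite size_cat z1 z2.
have fl' : flat_seg D (size p) (size (u1 ++ u2)) by rewrite zp zu.
have u0 : 0 < size (u1 ++ u2) by rewrite zu.
have yu := seg_lattice bP u0 fl'.
set nu := bshape _ _ _ in yu.
have in_range u : {subset u <= p ++ (u1 ++ u2) ++ q} -> all (fun r => 0 < r <= n + n) u.
  move=> su; apply/allP => r /su rb; rewrite (letter_le bP) // andbT lt0n.
  by apply: contraTneq rb => ->; apply: (valid_pos bP).
have au1 : all (fun r => 0 < r <= n + n) u1.
  by apply: in_range => r ru; rewrite !mem_cat ru orbT.
have au2 : all (fun r => 0 < r <= n + n) u2.
  by apply: in_range => r ru; rewrite !mem_cat ru !orbT.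
have nuN : nu (n + n).+1 = 0 by apply: bshape_large bP _ _ _ _.
have pe := bk_perm nuN s1 s2 au1 au2 yu.
have by' := bk_lattice nuN s1 s2 au1 au2 yu.
have bg' := rep_bounded bP u0 fl' pe by' bg.
have sz1 : size (bk1 (n + n) nu u1 u2) = a'.+1 by rewrite bk_size1.
have sz2 : size (bk2 (n + n) nu u1 u2) = a.+1 by rewrite bk_size2.
have [bk_1 bk_2] := bkK nuN s1 s2 au1 au2 yu.
have Eb' : bkswap i a.+1 a'.+1 b = p ++ (bk1 (n + n) nu u1 u2 ++ bk2 (n + n) nu u1 u2) ++ q.
  by rewrite Eb -zp -z1 -z2 bkswapE.
rewrite Eb'; split=> //.
  rewrite fits_cat /= !size_nseq !has_ascent_word_nseq -/i -zp take_size_cat //.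
  rewrite drop_size_cat // sp -catA.
  rewrite take_size_cat // sz1 eqxx dec_word_sorted.
  by rewrite drop_size_cat // take_size_cat // sz2 eqxx dec_word_sorted drop_size_cat.
rewrite -zp -sz1 -sz2 bkswapE.
have E : bshape (p ++ (bk1 (n + n) nu u1 u2 ++ bk2 (n + n) nu u1 u2) ++ q)
     (size p) (col_height D (size p)) =1 nu.
  move=> r; rewrite /nu /bshape (rep_take _ pe); last by left.
  by rewrite (rep_drop _ pe) //; apply: seg_off_diagonal bP u0 fl'.
by rewrite (eq_bk1 _ _ _ E) (eq_bk2 _ _ _ E) bk_1 bk_2.
Qed.

End Swap.

(** [enc] identifies a finite set [A] with the set of bounded words, which can
    thereby be counted. *)
Section Count.
Variables (n : nat) (D : sym_diagram n) (k : nat).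
Variables (T : finType) (A : {set T}) (enc : T -> seq nat).
Hypotheses (enc_bounded : forall t, t \in A -> bounded_word D k (enc t))
  (enc_inj : {in A &, injective enc})
  (enc_onto : forall b, bounded_word D k b -> exists2 t, t \in A & enc t = b).

Definition num_words (P : pred (seq nat)) := \sum_(t in A) (P (enc t) : nat).

(** The left inverse [g] makes [f] injective, and [enc] transports this to
    [A]. *)
Lemma num_le (P Q : pred (seq nat)) (f g : seq nat -> seq nat) :
  (forall b, bounded_word D k b -> P b -> [/\ bounded_word D k (f b), Q (f b) & g (f b) = b]) ->
  num_words P <= num_words Q.
Proof.
move=> fP; pose F t := odflt t [pick t' in A | enc t' == f (enc t)].
have FP t : t \in A -> P (enc t) -> F t \in A /\ enc (F t) = f (enc t).
  move=> tA Pt; rewrite /F; case: pickP => [t' /andP[t'A /eqP //]|no].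
  have [t' t'A E] := enc_onto (let: And3 h _ _ := fP _ (enc_bounded tA) Pt in h).
  by move: (no t'); rewrite /= t'A E eqxx.
pose S R := [set t in A | R (enc t)].
have numE R : num_words R = #|S R|.
  rewrite /num_words -sum1_card big_mkcond [in RHS]big_mkcond /=; apply: eq_bigr => t _.
  by rewrite inE; case: (t \in A) => //=; case: (R _).
rewrite !numE -(card_in_imset (f := F) (D := S P)).
  apply/subset_leq_card/subsetP => _ /imsetP[t + ->]; rewrite !inE => /andP[tA Pt].
  have [FA FE] := FP t tA Pt; rewrite FA FE.
  by have [] := fP _ (enc_bounded tA) Pt.
move=> t t'; rewrite !inE => /andP[tA Pt] /andP[tA' Pt'] E.
have [_ E1] := FP t tA Pt; have [_ E2] := FP t' tA' Pt'.
have [_ _ G1] := fP _ (enc_bounded tA) Pt; have [_ _ G2] := fP _ (enc_bounded tA') Pt'.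
by apply: enc_inj => //; rewrite -G1 -G2 -E1 -E2 E.
Qed.

Lemma num_swap C1 C2 a a' : flat_seg D (blocks_size C1) (a.+1 + a'.+1) ->
  num_words (fits (C1 ++ nseq a true :: nseq a' true :: C2))
    = num_words (fits (C1 ++ nseq a' true :: nseq a true :: C2)).
Proof.
move=> fl; apply/eqP; rewrite eqn_leq; apply/andP; split.
  apply: (num_le (f := bkswap D (blocks_size C1) a.+1 a'.+1)
                 (g := bkswap D (blocks_size C1) a'.+1 a.+1)).
  by move=> b bg sb; apply: bkswapP sb.
apply: (num_le (f := bkswap D (blocks_size C1) a'.+1 a.+1)
               (g := bkswap D (blocks_size C1) a.+1 a'.+1)).
by move=> b bg sb; apply: bkswapP sb; rewrite 1?addnC.
Qed.

Lemma num_split C1 C2 w1 w2 :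
  num_words (fits (C1 ++ w1 :: w2 :: C2))
    = num_words (fits (C1 ++ (w1 ++ true :: w2) :: C2))
      + num_words (fits (C1 ++ (w1 ++ false :: w2) :: C2)).
Proof. by rewrite /num_words -big_split; apply: eq_bigr => t _; apply: fits_split. Qed.

Lemma flat_sub i m i' m' : i <= i' -> i' + m' <= i + m ->
  flat_seg D i m -> flat_seg D i' m'.
Proof.
move=> le1 le2 fl t lt_t; have -> : i' + t = i + (i' - i + t) by lia.
by apply: fl; lia.
Qed.

Lemma word_split w : (exists a, w = nseq a true) \/
  exists a v, w = nseq a true ++ false :: v.
Proof.
elim: w => [|[] w IH]; first by left; exists 0.
  case: IH => [[a ->]|[a [v ->]]]; first by left; exists a.+1.
  by right; exists a.+1, v.
by right; exists 0, w.
Qed.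

(** Induction on the number of descents in [w].  By [num_split], a descent is a
    free junction minus an ascent, and each of these two cases has fewer
    descents; without descents this is [num_swap]. *)
Lemma num_commute C1 C2 a w : flat_seg D (blocks_size C1) (a.+1 + (size w).+1) ->
  num_words (fits (C1 ++ nseq a true :: w :: C2)) = num_words (fits (C1 ++ w :: nseq a true :: C2)).
Proof.
have [m le_m] : exists m, count negb w <= m by exists (count negb w).
elim: m w C1 C2 a le_m => [|m IH] w C1 C2 a le_m fl;
  case: (word_split w) => [[c Ew]|[c [v Ew]]].
- by rewrite Ew; apply: num_swap; move: fl; rewrite Ew size_nseq.
- by move: le_m; rewrite Ew count_cat /= addnS.
- by rewrite Ew; apply: num_swap; move: fl; rewrite Ew size_nseq.
have le_v : count negb v <= m.
  by move: le_m; rewrite Ew count_cat /= add1n addnS ltnS; apply: leq_trans (leq_addl _ _).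
have szw : size w = (c + size v).+1 by rewrite Ew size_cat size_nseq /= addnS.
have lenS (x : seq bool) : blocks_size (C1 ++ [:: x]) = blocks_size C1 + (size x).+1.
  by rewrite blocks_size_cat /blocks_size /= addn0.
have E1 := num_split (C1 ++ [:: nseq a true]) C2 (nseq c true) v.
have E2 := num_split C1 (nseq a true :: C2) (nseq c true) v.
have E3 : num_words (fits (C1 ++ nseq a true :: (nseq c true ++ true :: v) :: C2))
        = num_words (fits (C1 ++ (nseq c true ++ true :: v) :: nseq a true :: C2)).
  apply: IH; first by rewrite count_cat /= count_nseq mul0n !add0n.
  by move: fl; rewrite szw size_cat size_nseq /= !addnS.
have fl4 : flat_seg D (blocks_size C1) (a.+1 + c.+1) by apply: flat_sub fl => //; lia.
have fl5 : flat_seg D (blocks_size (C1 ++ [:: nseq c true])) (a.+1 + (size v).+1).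
  by apply: flat_sub fl; rewrite lenS size_nseq ?szw; lia.
have E4 := num_swap (v :: C2) fl4.
have E5 := IH v (C1 ++ [:: nseq c true]) C2 a le_v fl5.
rewrite -!catA /= -Ew in E1 E5; rewrite -Ew in E2.
by move: E1 E2; rewrite E4 E5 E3 => -> /addnI.
Qed.

(** The same induction.  The term with a free junction is reversed factor by
    factor, and [num_commute] puts the factors in the right order. *)
Lemma num_rev C1 C2 w : flat_seg D (blocks_size C1) (size w).+1 ->
  num_words (fits (C1 ++ w :: C2)) = num_words (fits (C1 ++ rev w :: C2)).
Proof.
have [m le_m] : exists m, count negb w <= m by exists (count negb w).
elim: m w C1 C2 le_m => [|m IH] w C1 C2 le_m fl;
  case: (word_split w) => [[c Ew]|[c [v Ew]]].
- by rewrite Ew rev_nseq.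
- by move: le_m; rewrite Ew count_cat /= addnS.
- by rewrite Ew rev_nseq.
have le_v : count negb v <= m.
  by move: le_m; rewrite Ew count_cat /= add1n addnS ltnS; apply: leq_trans (leq_addl _ _).
have szw : size w = (c + size v).+1 by rewrite Ew size_cat size_nseq /= addnS.
have lenS (x : seq bool) : blocks_size (C1 ++ [:: x]) = blocks_size C1 + (size x).+1.
  by rewrite blocks_size_cat /blocks_size /= addn0.
have rev_w d : rev (nseq c true ++ d :: v) = rev v ++ d :: nseq c true.
  by rewrite rev_cat rev_cons rev_nseq cat_rcons.
have E1 := num_split C1 C2 (nseq c true) v.
have E2 := num_split C1 C2 (rev v) (nseq c true).
have E3 : num_words (fits (C1 ++ (nseq c true ++ true :: v) :: C2))
        = num_words (fits (C1 ++ rev (nseq c true ++ true :: v) :: C2)).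
  apply: IH; first by rewrite count_cat /= count_nseq mul0n !add0n.
  by move: fl; rewrite szw size_cat size_nseq /= !addnS.
have fl4 : flat_seg D (blocks_size (C1 ++ [:: nseq c true])) (size v).+1.
  by apply: flat_sub fl; rewrite lenS size_nseq ?szw; lia.
have fl5 : flat_seg D (blocks_size C1) (c.+1 + (size (rev v)).+1).
  by apply: flat_sub fl => //; rewrite size_rev szw; lia.
have E4 := IH v (C1 ++ [:: nseq c true]) C2 le_v fl4.
have E5 := num_commute C2 fl5.
rewrite -!catA /= in E4; rewrite -!rev_w -Ew in E2; rewrite -Ew in E1.
by move: E1 E2; rewrite E4 E5 E3 => -> /addnI.
Qed.

End Count.

(** * Alternating patterns and peaks *)

Fixpoint alt (c : bool) k : seq bool :=
  if k is k'.+1 then [:: c, ~~ c & alt c k'] else [::].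

Lemma size_alt c k : size (alt c k) = k.*2.
Proof. by elim: k => //= k ->. Qed.

Lemma alt_rcons c k : alt c k.+1 = alt c k ++ [:: c; ~~ c].
Proof. by elim: k => //= k IH; rewrite -IH. Qed.

Lemma rev_alt c k : rev (alt c k) = alt (~~ c) k.
Proof. by elim: k => // k IH; rewrite alt_rcons rev_cat IH /= negbK. Qed.

(** For the word of a transversal and equal columns around [i], a peak at [i] if
    [c] is [true] and a valley if [c] is [false]. *)
Definition extremum (c : bool) (b : seq nat) i :=
  ((nth 0 b i <= nth 0 b i.-1) == c) && ((nth 0 b i.+1 <= nth 0 b i) == ~~ c).

(** [qs] marks the prescribed extrema among the columns that follow a block of
    [2 * k + 1] columns.  An extremum in the first of them forces the ascent
    pattern of the block to alternate for two more columns; otherwise the block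
    is complete.  Columns without condition form blocks of length one. *)
Fixpoint extremum_blocks c k (qs : seq bool) : seq (seq bool) :=
  match qs with
  | [::] => [:: alt c k]
  | true :: _ :: qs' => extremum_blocks c k.+1 qs'
  | _ :: qs' => alt c k :: extremum_blocks c 0 qs'
  end.

Fixpoint isolated (qs : seq bool) : bool :=
  match qs with
  | [::] => true
  | true :: d :: qs' => ~~ d && isolated qs'
  | d :: qs' => ~~ d && isolated qs'
  end.

Definition centers c (qs : seq bool) (b : seq nat) :=
  all (fun i => nth false qs i ==> extremum c b i.+1) (iota 0 (size qs)).

Lemma centers_cons c d qs a x s :
  centers c (d :: qs) [:: a, x & s]
    = (d ==> extremum c [:: a, x & s] 1) && centers c qs (x :: s).
Proof.
by rewrite /centers /= -[1]addn0 iotaDl all_map.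
Qed.

Lemma has_ascent_word_rcons2 c k u x y : size u = (k.*2).+1 ->
  has_ascent_word (alt c k.+1) (u ++ [:: x; y])
    = has_ascent_word (alt c k) u && extremum c [:: last 0 u; x; y] 1.
Proof.
case: u => // a s [E]; rewrite alt_rcons /= pairmap_cat /=.
by rewrite eqseq_cat ?size_pairmap ?size_alt // !eqseq_cons andbT.
Qed.

Lemma fits_blocks c k qs u s : isolated qs -> size s = size qs -> size u = (k.*2).+1 ->
  fits (extremum_blocks c k qs) (u ++ s)
    = has_ascent_word (alt c k) u && centers c qs (last 0 u :: s).
Proof.
have [m le_m] : exists m, size qs <= m by exists (size qs).
elim: m k qs u s le_m => [|m IH] k [|d qs] u s //= le_m iso sz su.
- rewrite (size0nil sz) cats0 size_alt take_oversize ?su // drop_oversize ?su //.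
- rewrite (size0nil sz) cats0 size_alt take_oversize ?su // drop_oversize ?su //.
case: s sz => // x s [sz]; rewrite centers_cons.
case: d iso => [|iso]; last first.
  rewrite /= size_alt -su take_size_cat // drop_size_cat //; congr (_ && _).
  by rewrite (IH 0 qs [:: x] s).
case: qs sz le_m => // d qs; case: s => // y s [sz] le_m /= /andP[/negPf -> iso].
have le_m' : size qs <= m by exact: ltnW le_m.
have su' : size (u ++ [:: x; y]) = (k.+1.*2).+1 by rewrite size_cat su doubleS addn2.
have := IH k.+1 qs _ s le_m' iso sz su'.
by rewrite -catA /= => ->; rewrite centers_cons has_ascent_word_rcons2 // last_cat /= -andbA.
Qed.

Section Extrema.
Variables (n : nat) (D : sym_diagram n) (k : nat).
Variables (T : finType) (A : {set T}) (enc : T -> seq nat).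
Hypotheses (enc_bounded : forall t, t \in A -> bounded_word D k (enc t))
  (enc_inj : {in A &, injective enc})
  (enc_onto : forall b, bounded_word D k b -> exists2 t, t \in A & enc t = b).
Local Notation num_words := (num_words A enc).

(** The blocks are treated one by one: the two alternating patterns of even
    length are the reverses of each other. *)
Lemma num_extremum_blocks C e qs : flat_seg D (blocks_size C) (e.*2).+1 ->
  (forall i, nth false qs i ->
     flat D (blocks_size C + e.*2 + i) /\ flat D (blocks_size C + e.*2 + i).+1) ->
  num_words (fits (C ++ extremum_blocks true e qs))
    = num_words (fits (C ++ extremum_blocks false e qs)).
Proof.
have [m le_m] : exists m, size qs <= m by exists (size qs).
elim: m C e qs le_m => [|m IH] C e qs le_m fl flq.
  case: qs le_m {flq} => // _ /=.
  by rewrite (num_rev enc_bounded enc_inj enc_onto) ?rev_alt ?size_alt.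
have close qs' : size qs' <= m -> (forall i, nth false qs' i ->
     flat D (blocks_size C + (e.*2).+1 + i) /\ flat D (blocks_size C + (e.*2).+1 + i).+1) ->
    num_words (fits (C ++ alt true e :: extremum_blocks true 0 qs'))
      = num_words (fits (C ++ alt false e :: extremum_blocks false 0 qs')).
  move=> le_q flq'; rewrite (num_rev enc_bounded enc_inj enc_onto) ?size_alt // rev_alt.
  have lenE : blocks_size (C ++ [:: alt false e]) = blocks_size C + (e.*2).+1.
    by rewrite blocks_size_cat /blocks_size /= size_alt addn0.
  have := IH (C ++ [:: alt false e]) 0 qs' le_q; rewrite -!catA; apply.
    by case.
  by move=> i qi; rewrite lenE addn0; apply: flq'.
case: qs le_m flq => [|[|] qs] le_m flq.
- by rewrite /= (num_rev enc_bounded enc_inj enc_onto) ?rev_alt ?size_alt.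
- have [f0 f1] := flq 0 isT; rewrite addn0 in f0 f1.
  case: qs le_m flq => [|d qs] le_m flq.
    by apply: (close [::]) => // i; rewrite nth_nil.
  apply: (IH C e.+1); [by move: le_m => /=; lia | |].
    move=> t; rewrite doubleS 2!ltnS leq_eqVlt => /orP[/eqP [->]|]; first by rewrite addnS.
    rewrite ltnS leq_eqVlt => /orP[/eqP -> //|]; exact: fl.
  move=> i qi; have := flq i.+2 qi; rewrite doubleS.
  by rewrite !addnS !addSn.
- by apply: (close qs) => // i qi; have := flq i.+1 qi; rewrite !addnS !addSn.
Qed.

Lemma num_extrema qs : (size qs).+1 = n -> isolated qs ->
  (forall i, nth false qs i -> flat D i /\ flat D i.+1) ->
  num_words (centers true qs) = num_words (centers false qs).
Proof.
move=> sz iso flq; have blocksE c : num_words (centers c qs)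
    = num_words (fits ([::] ++ extremum_blocks c 0 qs)).
  apply: eq_bigr => t tA; congr nat_of_bool.
  have := valid_size (enc_bounded tA).1; case: (enc t) => [|a s]; first by rewrite -sz.
  rewrite -sz => -[szs]; have := @fits_blocks c 0 qs [:: a] s iso szs erefl.
  by rewrite /= => ->.
by rewrite !blocksE; apply: (num_extremum_blocks (C := [::]) (e := 0)) => [t|i /flq].
Qed.

End Extrema.

(** * Fillings as symmetric arrays of bits *)

Lemma sorted_count_leq (la : seq nat) m i : sorted geq la -> 0 < m ->
  (i < count (leq m) la) = (m <= nth 0 la i).
Proof.
move=> + m0; elim: la i => [|a l IH] i; first by rewrite nth_nil [m <= 0]leqNgt m0.
move=> /= pl; have sl := path_sorted pl.
have /allP le_a : all (geq a) l by apply: order_path_min pl; apply: geq_trans.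
case: (leqP m a) => [le_m|lt_m]; first by case: i => [|i] //=; rewrite add1n ltnS IH.
have c0 : count (leq m) l = 0.
  by apply/eqP; rewrite -leqn0 leqNgt -has_count; apply/hasPn => b /le_a /= lb; lia.
rewrite c0; case: i => [|i] /=; first by rewrite [m <= a]leqNgt lt_m.
case: (ltnP i (size l)) => [lt_i|le_i]; last by rewrite nth_default // [m <= 0]leqNgt m0.
by have := le_a _ (mem_nth 0 lt_i) => /= lb; apply/esym/negbTE; lia.
Qed.

Lemma count1_uniq (S : eqType) (p : pred S) (s : seq S) a b : uniq s -> count p s = 1 ->
  a \in s -> b \in s -> p a -> p b -> a = b.
Proof.
move=> us c1 as_ bs pa pb; have : size (filter p s) = 1 by rewrite size_filter.
have : a \in filter p s by rewrite mem_filter pa.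
have : b \in filter p s by rewrite mem_filter pb.
by case: (filter p s) => [|c [|]] //; rewrite !inE => /eqP -> /eqP ->.
Qed.

Section Bridge.
Variable la : seq nat.
Hypotheses (hla : is_partition la) (hconj : self_conjugate la).
Let n := ncols la.

Let sla : sorted geq la. Proof. by case/andP: hla. Qed.

Lemma size_self_conj : size la = n.
Proof. by rewrite -(eqP hconj) size_map size_iota. Qed.

Lemma row_col i : i < n -> nth 0 la i = col_len la i.+1.
Proof.
by move=> lt_i; rewrite -{1}(eqP hconj) (nth_map 0) ?size_iota // nth_iota // add1n.
Qed.

Lemma part_le i : nth 0 la i <= n.
Proof.
case: (ltnP i (size la)) => [lt_i|le_i]; last by rewrite nth_default.
rewrite /n /ncols -nth0; case: la sla lt_i => //= a l pl; case: i => //= i lt_i.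
have /allP le_a : all (geq a) l by apply: order_path_min pl; apply: geq_trans.
exact: le_a (mem_nth 0 lt_i).
Qed.

(** Column [j] has as many squares as row [j], and the rows of length greater
    than [j] come first. *)
Lemma cellsC i j : (i < nth 0 la j) = (j < nth 0 la i).
Proof.
have half a b : b < n -> (a < nth 0 la b) = (b < nth 0 la a).
  by move=> lt_b; rewrite row_col // /col_len sorted_count_leq.
case: (ltnP j n) => [/half //|le_j]; case: (ltnP i n) => [/half -> //|le_i].
by rewrite !nth_default ?size_self_conj.
Qed.

Lemma cells_down i j i' j' : i' <= i -> j' <= j -> i < nth 0 la j -> i' < nth 0 la j'.
Proof.
move=> li lj lt_i; rewrite cellsC; apply: leq_ltn_trans lj _; rewrite cellsC.
exact: leq_ltn_trans li lt_i.
Qed.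

Lemma cells_lt i j : i < nth 0 la j -> i < n.
Proof. by move/leq_trans; apply; apply: part_le. Qed.

Lemma cells_col i : i < n -> i < nth 0 la 0.
Proof. by rewrite /n /ncols nth0. Qed.

Definition diagram_of : sym_diagram n := SymDiagram cellsC cells_down cells_lt cells_col.
Local Notation D := diagram_of.

Lemma squaresE i j : ((i.+1, j.+1) \in squares la) = D i j.
Proof.
apply/allpairsPdep/idP => [[b [a [_ + [Ea Eb]]]]|Dij].
  by rewrite -Ea -Eb mem_iota /= add1n ltnS.
exists j.+1, i.+1; split=> //; rewrite mem_iota /= add1n ltnS //.
by rewrite /nrows size_self_conj; move: (Dij : i < nth 0 la j); rewrite cellsC => /cells_lt.
Qed.

Lemma squares_gt0 i j : (i, j) \in squares la -> 0 < i /\ 0 < j.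
Proof. by case/allpairsPdep=> b [a []]; rewrite !mem_iota => /andP[? _] /andP[? _] [-> ->]. Qed.

Section Bits.
Variable T : filling la.

Definition bits i j := has_one T i.+1 j.+1.

Lemma has_one_sq i j : has_one T i j -> (i, j) \in squares la.
Proof. by rewrite /has_one; case: insubP. Qed.

Lemma ST_strans : T \in ST la -> sym_transversal D bits.
Proof.
rewrite inE => /andP[/andP[/allP Tcol _] /allP Tsym].
have cell i j : bits i j -> D i j by move/has_one_sq; rewrite squaresE.
have inrows i j : D i j -> j.+1 \in iota 1 (nrows la).
  move=> Dij; rewrite mem_iota /= add1n ltnS /nrows size_self_conj.
  by move: Dij; rewrite cellC; apply: cell_lt.
have incols i : i < n -> i.+1 \in iota 1 (ncols la).
  by move=> lt_i; rewrite mem_iota /= add1n ltnS.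
split=> //.
- move=> i j; case Dij: (D i j).
    by apply/eqP; apply: (Tsym (i.+1, j.+1)); rewrite squaresE.
  by apply/idP/idP => /cell; rewrite ?[D j i]cellC Dij.
- move=> i j j' x1 x2; have D1 := cell _ _ x1; have D2 := cell _ _ x2.
  have /eqP c1 := Tcol _ (incols _ (cell_lt D1)).
  have := count1_uniq (iota_uniq _ _) c1 (inrows _ _ D1) (inrows _ _ D2) x1 x2.
  by case.
- move=> i lt_i; have /eqP c1 := Tcol _ (incols _ lt_i).
  have : has (fun j => has_one T i.+1 j) (iota 1 (nrows la)) by rewrite has_count c1.
  by case/hasP=> -[|j]; rewrite mem_iota // => _ xij; exists j.
Qed.

Lemma one_rowE i j : T \in ST la -> bits i j -> one_row T i.+1 = j.+1.
Proof.
move=> TS xij; have xP := ST_strans TS; rewrite /one_row.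
have Dij := transv_cell xP xij.
have : j.+1 \in filter (has_one T i.+1) (iota 1 (nrows la)).
  rewrite mem_filter [has_one _ _ _]xij mem_iota /= add1n ltnS /nrows size_self_conj.
  by move: Dij; rewrite cellC; apply: cell_lt.
have : all (pred1 j.+1) (filter (has_one T i.+1) (iota 1 (nrows la))).
  apply/allP => -[|j']; rewrite mem_filter mem_iota /=; first by rewrite andbF.
  by case/andP=> xij' _; rewrite (transv_inj xP xij xij').
by case: filter => //= a s /andP[/eqP -> _].
Qed.

End Bits.

Definition fill (x : nat -> nat -> bool) : filling la :=
  [ffun s : seq_sub (squares la) => x (val s).1.-1 (val s).2.-1].

Lemma has_one_fill x i j : sym_transversal D x -> has_one (fill x) i.+1 j.+1 = x i j.
Proof.
move=> xP; rewrite /has_one; case: insubP => [s _ E|]; first by rewrite ffunE E.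
by rewrite squaresE => nD; apply/esym/negbTE; apply: contra nD; apply: transv_cell.
Qed.

Lemma count_one (p : pred nat) (m j : nat) : j < m -> p j.+1 ->
  (forall j', p j'.+1 -> j' = j) -> count p (iota 1 m) = 1.
Proof.
move=> lt_j pj un; rewrite (eq_in_count (a2 := pred1 j.+1)); last first.
  move=> [|j']; rewrite mem_iota //= => _; apply/idP/eqP => [/un -> //|[->]]; exact: pj.
by rewrite count_uniq_mem ?iota_uniq // mem_iota /= add1n ltnS lt_j.
Qed.

Lemma fill_ST x : sym_transversal D x -> fill x \in ST la.
Proof.
move=> xP; rewrite inE; apply/andP; split; last first.
  apply/allP => -[i j] sq; have [] := squares_gt0 sq.
  by case: i j {sq} => [|i] [|j] //= _ _; rewrite !has_one_fill // (transvC xP).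
apply/andP; split; apply/allP => -[|i]; rewrite mem_iota //= add1n ltnS => lt_i.
  have [j xij] := transv_ex xP lt_i.
  have Dij := transv_cell xP xij.
  apply/eqP/(@count_one _ _ j); rewrite ?has_one_fill //.
    by rewrite /nrows size_self_conj; move: Dij; rewrite cellC; apply: cell_lt.
  move=> j'; rewrite has_one_fill // => xij'; exact: (transv_inj xP xij' xij).
rewrite /nrows size_self_conj in lt_i.
have [j xij] := transv_ex xP lt_i; have Dij := transv_cell xP xij.
apply/eqP/(@count_one _ _ j); rewrite ?has_one_fill //.
- by move: Dij; rewrite cellC; apply: cell_lt.
- by rewrite (transvC xP).
by move=> j'; rewrite has_one_fill // (transvC xP) => xij'; exact: (transv_inj xP xij' xij).
Qed.

Lemma bits_inj (T T' : filling la) : bits T =2 bits T' -> T = T'.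
Proof.
move=> E; apply/ffunP => s.
have H (U : filling la) : has_one U (val s).1 (val s).2 = U s.
  by rewrite /has_one -surjective_pairing valK.
have [p0 q0] : 0 < (val s).1 /\ 0 < (val s).2.
  by apply: squares_gt0; rewrite -surjective_pairing; apply: valP.
have := E (val s).1.-1 (val s).2.-1.
by rewrite /bits !prednK // !H.
Qed.

Definition enc (T : filling la) := word n D (bits T).

Lemma enc_valid T : T \in ST la -> valid D (enc T).
Proof. by move/ST_strans; apply: word_valid. Qed.

Lemma enc_inj : {in ST la &, injective enc}.
Proof.
move=> T T' /ST_strans xP /ST_strans xP' E; apply: bits_inj.
exact: word_inj xP xP' E.
Qed.

Lemma enc_onto b : valid D b -> exists2 T, T \in ST la & enc T = b.
Proof.
move=> /valid_realized [x xP <-]; exists (fill x); first exact: fill_ST.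
apply/eq_mkseq => i; apply: (label_unique (g := label D (bits (fill x)))) => [a|a c].
  exact: label0.
by rewrite labelS /bits has_one_fill.
Qed.

End Bridge.

(** * Forbidden patterns as chains *)

Lemma dec_trans : transitive dec.
Proof. by move=> [a b] [c d] [e f]; rewrite /dec /=; lia. Qed.

Section Patterns.
Variable la : seq nat.
Hypotheses (hla : is_partition la) (hconj : self_conjugate la).
Let n := ncols la.
Local Notation D := (diagram_of hla hconj).
Local Notation enc := (enc hla hconj).
Variable T : filling la.
Hypothesis TS : T \in ST la.
Let xP : sym_transversal D (bits T) := ST_strans hla hconj TS.

(** [c] lists the 1s of an occurrence from left to right, and [(i, j)] is the
    outer corner of the rectangle that it spans. *)
Lemma contains_patternP k (s : 'S_k.+1) :
  contains_pattern T s <-> exists i j c,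
    [/\ grid_point D i j /\ 0 < i, size c = k.+1, all (inrect (bits T) i j) c,
        forall a b : 'I_k.+1, a < b -> (nth (0, 0) c a).1 < (nth (0, 0) c b).1
      & forall a b : 'I_k.+1, s a < s b -> (nth (0, 0) c a).2 < (nth (0, 0) c b).2].
Proof.
split.
  case/existsP=> r /existsP[c /and4P[/forallP rP /forallP cP /forallP sq /forallP one]].
  have {}rP (a b : 'I_k.+1) : a < b -> r a < r b.
    by move=> ab; have /forallP/(_ b)/implyP := rP a; apply.
  have {}cP (a b : 'I_k.+1) : a < b -> c a < c b.
    by move=> ab; have /forallP/(_ b)/implyP := cP a; apply.
  have {}sq (a b : 'I_k.+1) : (nat_of_ord (c a), nat_of_ord (r b)) \in squares la.
    by have /forallP := sq a; apply.
  have {}one (a : 'I_k.+1) : has_one T (c a) (r (s a)).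
    by have /forallP/(_ (s a)) := one a; rewrite eqxx => /eqP.
  have c0 a : 0 < c a by have [] := squares_gt0 (sq a a).
  have r0 a : 0 < r a by have [] := squares_gt0 (sq a a).
  have le_max m (f : 'I_k.+1 -> 'I_m) (a : 'I_k.+1) :
      (forall a b : 'I_k.+1, a < b -> f a < f b) -> f a <= f ord_max.
    move=> fP; case: (eqVneq a ord_max) => [-> //|ne]; apply/ltnW/fP.
    by rewrite ltn_neqAle -ltnS ltn_ord andbT.
  pose p (a : 'I_k.+1) := ((c a).-1, (r (s a)).-1).
  have pE (a : 'I_k.+1) : nth (0, 0) [seq p b | b <- enum 'I_k.+1] a = p a.
    by rewrite (nth_map ord0) ?size_enum_ord // nth_ord_enum.
  exists (nat_of_ord (c ord_max)), (nat_of_ord (r ord_max)), [seq p b | b <- enum 'I_k.+1]; split.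
  - split; last exact: c0.
    have H : D (c ord_max).-1 (r ord_max).-1 by rewrite -(squaresE hla hconj) !prednK.
    by rewrite /grid_point H !orbT.
  - by rewrite size_map size_enum_ord.
  - apply/allP => _ /mapP[a _ ->]; rewrite /inrect /= !prednK // le_max //.
    by rewrite le_max //= /bits !prednK.
  - move=> a b ab; rewrite !pE /=.
    by rewrite -ltnS !prednK // cP.
  - move=> a b ab; rewrite !pE /=.
    by rewrite -ltnS !prednK // rP.
case=> i [j [c [[ip i0] sz /allP cR cinc rinc]]].
have cin (a : 'I_k.+1) : inrect (bits T) i j (nth (0, 0) c a).
  by apply: cR; rewrite mem_nth // sz.
pose C : {ffun 'I_k.+1 -> 'I_(ncols la).+1} := [ffun a => inord (nth (0, 0) c (nat_of_ord a)).1.+1].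
pose R : {ffun 'I_k.+1 -> 'I_(nrows la).+1} :=
  [ffun a => inord (nth (0, 0) c (nat_of_ord ((s^-1)%g a))).2.+1].
have Dc a : D (nth (0, 0) c (nat_of_ord (a : 'I_k.+1))).1 (nth (0, 0) c a).2 := inrectD ip (cin a).
have CE a : C a = (nth (0, 0) c (nat_of_ord a)).1.+1 :> nat.
  by rewrite ffunE inordK // ltnS (cell_lt (Dc a)).
have RE a : R a = (nth (0, 0) c (nat_of_ord ((s^-1)%g a))).2.+1 :> nat.
  rewrite ffunE inordK // ltnS /nrows (size_self_conj hconj).
  by have := Dc ((s^-1)%g a); rewrite cellC => /cell_lt.
apply/existsP; exists R; apply/existsP; exists C; apply/and4P; split.
- apply/forallP => a; apply/forallP => b; apply/implyP => ab.
  by rewrite !RE ltnS; apply: rinc; rewrite !permKV.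
- apply/forallP => a; apply/forallP => b; apply/implyP => ab.
  by rewrite !CE ltnS; apply: cinc.
- apply/forallP => a; apply/forallP => b; rewrite CE RE (squaresE hla hconj).
  have /and3P[p1 _ _] := cin a; have /and3P[_ p2 _] := cin ((s^-1)%g b).
  by apply: (@inrectD _ D i j (_, _) (fun _ _ => true) ip); rewrite /inrect /= p1 p2.
- apply/forallP => a; apply/forallP => b; rewrite CE RE; apply/eqP.
  have /and3P[_ _ xa] := cin a.
  apply/idP/eqP => [xb|->]; last by rewrite permK.
  have E := transv_inj xP xa xb.
  case: (ltngtP (s a) b) => [lt_ab|lt_ba|/val_inj //].
    by have := rinc a ((s^-1)%g b); rewrite permKV E ltnn => /(_ lt_ab).
  by have := rinc ((s^-1)%g b) a; rewrite permKV E ltnn => /(_ lt_ba).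
Qed.

(** Going down the last column of a rectangle to the boundary; as the parts of
    the shapes only grow, chains need to be measured at boundary points only. *)
Lemma boundary_above i j : grid_point D i j -> 0 < i -> 0 < j ->
  exists i' j', [/\ boundary n D i' j', i <= i' & j <= j'].
Proof.
case: i j => [|i] [|j] // Dij _ _; have lt_i := cell_lt (Dij : D i j).
exists i.+1, (col_height D i); split=> //; first exact: boundary_right.
by rewrite -col_heightP.
Qed.

Lemma Ipat_has_inc k : contains_pattern T (Ipat k.+1) <-> has_inc D (enc T) k.+1.
Proof.
have IE (a : 'I_k.+1) : Ipat k.+1 a = a by rewrite /Ipat permE.
rewrite contains_patternP; split.
  case=> i [j [c [[ip i0] sz cR c1 c2]]].
  have sc : sorted inc c.
    rewrite (sorted_pairwise inc_trans); apply/(pairwiseP (0, 0)) => a b.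
    rewrite !inE sz => la_ lb ab; have := c1 (Ordinal la_) (Ordinal lb) ab.
    by have := c2 (Ordinal la_) (Ordinal lb); rewrite !IE /inc => /(_ ab) /= -> ->.
  have j0 : 0 < j by case: c sz cR {sc c1 c2} => //= p c _ /andP[/and3P[_ + _] _]; case: j ip.
  have [i' [j' [bij li lj]]] := boundary_above ip i0 j0.
  exists i', j'; split=> //; rewrite (word_bshape xP) // -sz.
  exact: leq_trans (inc_chain_gshape xP sc cR) (gshape_mono xP (ltnSn 0) li lj).
case=> i [j [bij]]; rewrite (word_bshape xP) // => le_k.
have /and4P[_ _ ip _] := bij.
have [c [sc cR sz]] := gshape_inc_chain xP ip le_k.
exists i, j, c; move: sc; rewrite (sorted_pairwise inc_trans) => /(pairwiseP (0, 0)) cP.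
have cinc (a b : 'I_k.+1) : a < b -> inc (nth (0, 0) c a) (nth (0, 0) c b).
  by apply: cP; rewrite inE sz.
split=> //.
- by split=> //; case: (i) le_k; rewrite ?gshape0l.
- by move=> a b /cinc/andP[].
- by move=> a b; rewrite !IE => /cinc/andP[].
Qed.

Lemma Jpat_has_dec k : contains_pattern T (Jpat k.+1) <-> has_dec D (enc T) k.+1.
Proof.
have JE (a b : 'I_k.+1) : (Jpat k.+1 a < Jpat k.+1 b) = (b < a).
  by rewrite /Jpat !permE /=; have := ltn_ord a; have := ltn_ord b; lia.
rewrite contains_patternP; split.
  case=> i [j [c [[ip i0] sz cR c1 c2]]].
  have sc : sorted dec c.
    rewrite (sorted_pairwise dec_trans); apply/(pairwiseP (0, 0)) => a b.
    rewrite !inE sz => la_ lb ab; have := c1 (Ordinal la_) (Ordinal lb) ab.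
    by have := c2 (Ordinal lb) (Ordinal la_); rewrite !JE /dec => /(_ ab) /= -> ->.
  have j0 : 0 < j by case: c sz cR {sc c1 c2} => //= p c _ /andP[/and3P[_ + _] _]; case: j ip.
  have [i' [j' [bij li lj]]] := boundary_above ip i0 j0.
  exists i', j'; split=> //; rewrite (word_bshape xP) // -sz.
  have := dec_chain_gshape xP ip _ sc cR; rewrite sz => /(_ isT) /leq_trans; apply.
  exact: gshape_mono.
case=> i [j [bij]]; rewrite (word_bshape xP) // => le_k.
have /and4P[_ _ ip _] := bij.
have [c [sc cR sz]] := gshape_dec_chain xP ip (ltn0Sn k) le_k.
exists i, j, c; move: sc; rewrite (sorted_pairwise dec_trans) => /(pairwiseP (0, 0)) cP.
have cdec (a b : 'I_k.+1) : a < b -> dec (nth (0, 0) c a) (nth (0, 0) c b).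
  by apply: cP; rewrite inE sz.
split=> //.
- by split=> //; case: (i) le_k; rewrite ?gshape0l.
- by move=> a b /cdec/andP[].
- by move=> a b; rewrite JE => /cdec/andP[].
Qed.

End Patterns.

(** * The four generating functions *)

Lemma isolatedP (qs : seq bool) :
  (forall i, nth false qs i -> ~~ nth false qs i.+1 /\ i.+1 < size qs) -> isolated qs.
Proof.
have [m le_m] : exists m, size qs <= m by exists (size qs).
elim: m qs le_m => [|m IH] [|[|] qs] // le_m H.
  case: qs le_m H => [|d qs] le_m H; first by have [] := H 0 isT.
  have [/= nd _] := H 0 isT; rewrite /= nd /=; apply: IH; first exact: ltnW.
  by move=> i qi; have [] := H i.+2 qi.
by apply: (IH qs) => // i qi; have [] := H i.+1 qi.
Qed.

Lemma num_words0 (T : finType) (A : {set T}) (enc : T -> seq nat) P :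
  (forall t, t \in A -> ~~ P (enc t)) -> num_words A enc P = 0.
Proof. by move=> H; rewrite /num_words big1 // => t /H /negPf ->. Qed.

Section Main.
Variable la : seq nat.
Hypotheses (hla : is_partition la) (hconj : self_conjugate la).
Let n := ncols la.
Local Notation D := (diagram_of hla hconj).
Local Notation enc := (enc hla hconj).

Lemma flat_atP i : flat_at la i ->
  exists2 a, i = a.+2 & [/\ a.+2 < n, flat D a & flat D a.+1].
Proof.
case: i => [|[|a]] // /and4P[_ lt_a /eqP c1 /eqP c2]; exists a => //.
have lt_n : a.+2 < n by move: lt_a; rewrite -/n; case: (n).
have rows b b' : b < n -> b' < n -> col_len la b.+1 = col_len la b'.+1 ->
    forall j, D b j = D b' j.
  move=> lb lb' E j; rewrite !(cellC D _ j) /=.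
  by rewrite !(row_col hconj) // E.
by split=> //; apply: rows => //; rewrite ?(ltnW lt_n) ?(ltnW (ltnW lt_n)).
Qed.

Definition extremum_set (c : bool) (T : filling la) := if c then Peak T else Val T.

Lemma in_extremum_set c T i : T \in ST la ->
  (i \in extremum_set c T) = flat_at la i && extremum c (enc T) i.-1.
Proof.
move=> TS; have xP := ST_strans hla hconj TS.
have -> : (i \in extremum_set c T) = flat_at la i &&
    (if c then (one_row T i.-1 < one_row T i) && (one_row T i.+1 < one_row T i)
     else (one_row T i < one_row T i.-1) && (one_row T i < one_row T i.+1)).
  by rewrite /extremum_set; case: c; rewrite inE.
case fi: (flat_at la i) => //=.
have [a -> [lt_n f0 f1]] := flat_atP fi; rewrite /=.
have [t0 x0] := transv_ex xP (ltnW (ltnW lt_n)).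
have [t1 x1] := transv_ex xP (ltnW lt_n); have [t2 x2] := transv_ex xP lt_n.
rewrite (one_rowE hla hconj TS x0) (one_rowE hla hconj TS x1) (one_rowE hla hconj TS x2) !ltnS.
have ne a1 a2 s1 s2 : a1 != a2 -> bits T a1 s1 -> bits T a2 s2 -> s1 != s2.
  move=> nea y1 y2; apply: contra nea => /eqP E; rewrite E (transvC xP) in y1.
  by rewrite (transvC xP) in y2; rewrite (transv_inj xP y1 y2).
have n01 : t0 != t1 by apply: ne x0 x1; rewrite neq_ltn ltnSn.
have n12 : t1 != t2 by apply: ne x1 x2; rewrite neq_ltn ltnSn.
rewrite /extremum /= -(word_ascent xP f0 (ltnW lt_n) x0 x1) -(word_ascent xP f1 lt_n x1 x2).
by case: c; case: (ltngtP t0 t1) n01 => //= _ _; case: (ltngtP t1 t2) n12.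
Qed.

Lemma extremum_conj_word c T i : T \in ST la -> flat_at la i ->
  extremum c (conj_word D (enc T)) i.-1 = extremum (~~ c) (enc T) i.-1.
Proof.
move=> TS fi; have [a -> [lt_n f0 f1]] := flat_atP fi; have bP := enc_valid hla hconj TS.
rewrite /extremum /= (conj_word_descent bP f0 (ltnW lt_n)) (conj_word_descent bP f1 lt_n).
by case: c; case: (nth 0 _ a.+1 <= _); case: (_ <= _).
Qed.

Lemma ST_avoiding_IP k T : T \in ST_avoiding la (Ipat k.+1) <->
  T \in ST la /\ bounded_word D k.+1 (enc T).
Proof.
rewrite inE; split=> [/andP[TS nc]|[TS [_ g]]].
  split=> //; split; first exact: enc_valid.
  move=> i j bij; rewrite ltnNge; apply: contra nc => le_k.
  by apply/(Ipat_has_inc hla hconj TS); exists i, j.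
rewrite TS; apply/negP => /(Ipat_has_inc hla hconj TS) [i [j [bij]]].
by rewrite leqNgt g.
Qed.

(** If [Q] contains two adjacent columns, or a column without two neighbours of
    its own length, both sums vanish.  In the remaining cases [Q] is a
    set of isolated centers. *)
Lemma num_peak_val k (Q : {set 'I_n.+1}) :
  \sum_(T in ST_avoiding la (Ipat k.+1)) (Q \subset extremum_set true T : nat)
    = \sum_(T in ST_avoiding la (Ipat k.+1)) (Q \subset extremum_set false T : nat).
Proof.
pose P c (b : seq nat) := [forall i : 'I_n.+1 in Q, flat_at la i && extremum c b i.-1].
set A := ST_avoiding la _.
have AS T : T \in A -> T \in ST la by case/ST_avoiding_IP.
have numE c : \sum_(T in A) (Q \subset extremum_set c T : nat) = num_words A enc (P c).
  apply: eq_bigr => T TA; congr nat_of_bool; apply/subsetP/forall_inP => H i iQ.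
    by rewrite -in_extremum_set ?H // AS.
  by rewrite in_extremum_set ?H // AS.
rewrite !numE.
case: (set_0Vmem Q) => [Q0|[i0 i0Q]].
  by apply: eq_bigr => T _; congr nat_of_bool; apply/forall_inP/forall_inP => _ i; rewrite Q0 inE.
case flQ: [forall i in Q, flat_at la i]; last first.
  have Z c : num_words A enc (P c) = 0.
    apply: num_words0 => T _; apply/negP => /forall_inP H; move/negP: flQ; apply.
    by apply/forall_inP => i /H /andP[].
  by rewrite !Z.
move/forall_inP: flQ => flQ.
have [a0 _ [lt_n _ _]] := flat_atP (flQ _ i0Q).
pose q i := (inord i : 'I_n.+1) \in Q.
have qP i : i <= n -> q i -> flat_at la i by move=> le_i /flQ; rewrite inordK.
have PE c b : P c b = [forall i : 'I_n.+1 in Q, extremum c b i.-1].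
  by apply/forall_inP/forall_inP => H i iQ; [have /andP[] := H i iQ | rewrite flQ // H].
case adj: [exists i in Q, q i.+1 && (i < n)].
  case/exists_inP: adj => i iQ /andP[qi lt_i].
  have Z c : num_words A enc (P c) = 0.
    apply: num_words0 => T _; rewrite PE; apply/negP => /forall_inP H.
    have := H _ iQ; have := H _ qi; rewrite inordK // => /andP[/eqP /= e1 _] /andP[_ /eqP].
    have [a Ea _] := flat_atP (flQ _ iQ); rewrite /= Ea /= in e1 *.
    by rewrite e1; case: (c).
  by rewrite !Z.
(* Index i of qs is the column i + 2 of Q, numbered from 1: the first column
   cannot be an extremum. *)
pose qs := mkseq (fun i => q i.+2) n.-1.
have n0 : 0 < n by apply: leq_ltn_trans lt_n.
have qsE i : nth false qs i -> [/\ i.+2 <= n, q i.+2 & i < n.-1].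
  case: (ltnP i n.-1) => [lt_i|le_i]; last by rewrite nth_default ?size_mkseq.
  by rewrite nth_mkseq // => qi; split=> //; rewrite -(prednK n0).
have centersE c b : centers c qs b = P c b.
  rewrite PE /centers size_mkseq; apply/allP/forall_inP => [H i iQ|H i].
    have [a Ea [lt_a _ _]] := flat_atP (flQ _ iQ); rewrite /= Ea /=.
    have la1 : a < n.-1 by rewrite -ltnS prednK // ltnW.
    have := H a; rewrite mem_iota /= add0n la1 nth_mkseq // => /(_ isT)/implyP; apply.
    by rewrite /q -Ea inord_val.
  rewrite mem_iota add0n => /andP[_ lt_i]; apply/implyP => /qsE [le_i qi _].
  by have := H _ qi; rewrite inordK.
have numC c : num_words A enc (P c) = num_words A enc (centers c qs).
  by apply: eq_bigr => T _; rewrite centersE.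
rewrite !numC; apply: (@num_extrema n D k.+1).
- by move=> T /ST_avoiding_IP [].
- by move=> T T' /AS TS /AS TS'; apply: enc_inj.
- move=> b bg; have [T TS E] := enc_onto bg.1.
  by exists T => //; apply/ST_avoiding_IP; rewrite E.
- by rewrite size_mkseq prednK.
- apply: isolatedP => i /qsE [le_i qi lt_i].
  have [a [Ea] [lt_a _ _]] := flat_atP (qP _ le_i qi); rewrite -Ea in lt_a.
  have lt_i1 : i.+1 < n.-1 by rewrite -ltnS prednK.
  rewrite size_mkseq nth_mkseq //; split=> //; apply: contraFN adj => qi1.
  by apply/exists_inP; exists (inord i.+2) => //; rewrite inordK // qi1.
- move=> i /qsE [le_i qi _].
  by have [a [->] []] := flat_atP (qP _ le_i qi).
Qed.

Import GRing.Theory.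
Local Open Scope ring_scope.

(** Expanding [X i = (X i - 1) + 1] turns a weighted sum over transversals into
    counts of those whose set of extrema contains a given set. *)
Lemma prod_subsets (R : comNzRingType) (I : finType) (E : {set I}) (X : I -> R) :
  \prod_(i in E) X i = \sum_(Q : {set I} | Q \subset E) \prod_(i in Q) (X i - 1).
Proof.
transitivity (\prod_i ((if i \in E then X i - 1 else 0) + 1)).
  rewrite big_mkcond; apply: eq_bigr => i _; case: ifP => _; first by rewrite subrK.
  by rewrite add0r.
rewrite bigA_distr [RHS]big_mkcond; apply: eq_bigr => Q _.
case: ifP => [QE|/negbT nQE].
  rewrite [RHS]big_mkcond; apply: eq_bigr => i _; case: ifP => // iQ.
  by rewrite (subsetP QE).
have /subsetPn[i iQ niE] := nQE.
by rewrite (bigD1 i) //= iQ (negPf niE) mul0r.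
Qed.

Lemma peak_val k :
  \sum_(T in ST_avoiding la (Ipat k.+1)) tmon (Peak T)
    = \sum_(T in ST_avoiding la (Ipat k.+1)) tmon (Val T).
Proof.
have expand c : \sum_(T in ST_avoiding la (Ipat k.+1)) tmon (extremum_set c T)
    = \sum_(Q : {set 'I_n.+1}) (\prod_(i in Q) ('X_i - 1)) *+
        (\sum_(T in ST_avoiding la (Ipat k.+1)) (Q \subset extremum_set c T : nat))%N.
  under eq_bigr => T _ do rewrite /tmon prod_subsets big_mkcond /=.
  rewrite exchange_big; apply: eq_bigr => Q _; rewrite -sumrMnr.
  by apply: eq_bigr => T _; case: (Q \subset _).
have := expand true; rewrite /extremum_set => ->; have := expand false; rewrite /extremum_set => ->.
by apply: eq_bigr => Q _; rewrite num_peak_val.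
Qed.

Definition conj_transversal (T : filling la) : filling la :=
  odflt T [pick T' in ST la | enc T' == conj_word D (enc T)].

Lemma conj_transversalP T : T \in ST la ->
  conj_transversal T \in ST la /\ enc (conj_transversal T) = conj_word D (enc T).
Proof.
move=> TS; rewrite /conj_transversal; case: pickP => [T' /andP[T'S /eqP //]|no].
have [T' T'S E] := enc_onto (conj_word_valid (enc_valid hla hconj TS)).
by move: (no T'); rewrite /= T'S E eqxx.
Qed.

Lemma conj_transversalK T : T \in ST la -> conj_transversal (conj_transversal T) = T.
Proof.
move=> TS; have [GS GE] := conj_transversalP TS; have [GGS GGE] := conj_transversalP GS.
apply: (enc_inj GGS TS); rewrite GGE GE conj_wordK //; exact: enc_valid.
Qed.

Lemma conj_transversal_avoid k T : T \in ST la ->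
  (conj_transversal T \in ST_avoiding la (Jpat k.+1)) = (T \in ST_avoiding la (Ipat k.+1)).
Proof.
move=> TS; have [GS GE] := conj_transversalP TS.
rewrite ![_ \in ST_avoiding _ _]inE GS TS; congr negb.
apply/idP/idP => [/(Jpat_has_dec hla hconj GS)|/(Ipat_has_inc hla hconj TS) H].
  rewrite GE => /(has_dec_conj_word (enc_valid hla hconj TS) (ltn0Sn k)).
  by move/(Ipat_has_inc hla hconj TS).
apply/(Jpat_has_dec hla hconj GS); rewrite GE; apply/has_dec_conj_word => //.
exact: enc_valid TS.
Qed.

Lemma sum_conj k c :
  \sum_(T in ST_avoiding la (Jpat k.+1)) tmon (extremum_set (~~ c) T)
    = \sum_(T in ST_avoiding la (Ipat k.+1)) tmon (extremum_set c T).
Proof.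
(* Outside of ST la the map need not be injective; there the condition that it
   undoes itself fails, because its values lie in ST la. *)
rewrite (reindex_onto conj_transversal conj_transversal) /=; last first.
  by move=> T; rewrite inE => /andP[/conj_transversalK].
apply: eq_big => [T|T /andP[GA /eqP GK]].
  case TS: (T \in ST la).
    by rewrite conj_transversal_avoid // conj_transversalK // eqxx andbT.
  rewrite [RHS]inE TS /=; apply/negP => /andP[]; rewrite inE => /andP[GS _] /eqP E.
  by have [] := conj_transversalP GS; rewrite E TS.
have TS : T \in ST la by move: GA; rewrite inE => /andP[/conj_transversalP []]; rewrite GK.
have [GS GE] := conj_transversalP TS; congr tmon; apply/setP => i.
rewrite !in_extremum_set // GE; case fi: (flat_at la i) => //=.
by rewrite extremum_conj_word // negbK.
Qed.

End Main.

Local Open Scope ring_scope.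

Theorem theorem1p5 (k : nat) (hk : (1 <= k)%N) (la : seq nat)
    (hla : is_partition la) (hconj : self_conjugate la) :
  [/\ \sum_(T in ST_avoiding la (Ipat k)) tmon (Peak T)
        = \sum_(T in ST_avoiding la (Ipat k)) tmon (Val T),
      \sum_(T in ST_avoiding la (Ipat k)) tmon (Val T)
        = \sum_(T in ST_avoiding la (Jpat k)) tmon (Val T)
    & \sum_(T in ST_avoiding la (Jpat k)) tmon (Val T)
        = \sum_(T in ST_avoiding la (Jpat k)) tmon (Peak T)].
Proof.
case: k hk => // k _.
have IPV := peak_val hla hconj k.
have JV := sum_conj hla hconj k true.
have JP := sum_conj hla hconj k false.
split.
- exact: IPV.
- exact: etrans (esym IPV) (esym JV).
- exact: etrans JV (etrans IPV (esym JP)).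
Qed.
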